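(* Let $\mathcal C$ be a (strict) braided monoidal category in which idempotents split, and let $A=(A,\mathrm m_A,\eta_A,\Delta_A,\varepsilon_A)$ be a bialgebra in $\mathcal C$. Then the following statements are equivalent. (1) There is a trivalent Hopf datum $(B_1,B_2,\mu_l,\nu_l,\mu_r,\nu_r)$ in $\mathcal C$ such that the corresponding bialgebra $B=B_1\otimes B_2$ (with structure $\mathrm m_B,\eta_B,\Delta_B,\varepsilon_B$) is bialgebra isomorphic to $A$. (2) $A$ is bialgebra isomorphic to a trivalent cross product bialgebra. (3) There are objects $B_1,B_2$ of $\mathcal C$, each of which is both an algebra and a coalgebra, algebra morphisms $\mathrm i_j:B_j\to A$ and coalgebra morphisms $\mathrm p_j:A\to B_j$ such that $\mathrm p_j\circ\mathrm i_j=\mathrm{id}_{B_j}$ for $j\in\{1,2\}$, $\mathrm m_A\circ(\mathrm i_1\otimes\mathrm i_2)=\big((\mathrm p_1\otimes\mathrm p_2)\circ\Delta_A\big)^{-1}$, and one of the morphisms $\mathrm i_1,\mathrm i_2,\mathrm p_1,\mathrm p_2$ is both an algebra and a coalgebra morphism. (4) There are idempotents $\Pi_1,\Pi_2\in\mathrm{End}(A)$ such that for every $j\in\{1,2\}$ $$\mathrm m_A\circ(\Pi_j\otimes\Pi_j)=\Pi_j\circ\mathrm m_A\circ(\Pi_j\otimes\Pi_j),\quad \Pi_j\circ\eta_A=\eta_A,$$ $$(\Pi_j\otimes\Pi_j)\circ\Delta_A=(\Pi_j\otimes\Pi_j)\circ\Delta_A\circ\Pi_j,\quad \varepsilon_A\circ\Pi_j=\varepsilon_A,$$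 the sequence $A\otimes A\xrightarrow{\mathrm m_A\circ(\Pi_1\otimes\Pi_2)}A\xrightarrow{(\Pi_1\otimes\Pi_2)\circ\Delta_A}A\otimes A$ is a splitting of the idempotent $\Pi_1\otimes\Pi_2$ of $A\otimes A$, and one of the idempotents $\Pi_1,\Pi_2$ is either an algebra or a coalgebra morphism.
   Context: Throughout, $\mathcal C$ has tensor product $\otimes$, unit object $I$, braiding $\Psi$. Algebras are unital associative, coalgebras counital coassociative, bialgebras are taken in the braided sense: $\Delta\circ\mathrm m=(\mathrm m\otimes\mathrm m)\circ(\mathrm{id}\otimes\Psi\otimes\mathrm{id})\circ(\Delta\otimes\Delta)$, with $\varepsilon$ an algebra morphism and $\eta$ a coalgebra morphism. Write $\mathrm{id}_j=\mathrm{id}_{B_j}$, $\Psi_{i,j}=\Psi_{B_i,B_j}$. Splitting: morphisms $p:M\to N$, $i:N\to M$ (the sequence $M\xrightarrow{p}N\xrightarrow{i}M$) split an idempotent $\Pi:M\to M$ if $p\circ i=\mathrm{id}_N$ and $i\circ p=\Pi$. Cross product bialgebra. A bialgebra admissible tuple (BAT) consists of objects $B_j$ ($j=1,2$), each with an algebra structure $(\mathrm m_j,\eta_j)$ and a coalgebra structure $(\Delta_j,\varepsilon_j)$ with $\varepsilon_j\circ\eta_j=\mathrm{id}_I$, and morphisms $\varphi_{1,2}:B_1\otimes B_2\to B_2\otimes B_1$, $\varphi_{2,1}:B_2\otimes B_1\to B_1\otimes B_2$, such that $B_1\otimes B_2$ is a bialgebra with $\mathrm m_\times=(\mathrm m_1\otimes\mathrm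 m_2)\circ(\mathrm{id}_1\otimes\varphi_{2,1}\otimes\mathrm{id}_2)$, $\eta_\times=\eta_1\otimes\eta_2$, $\Delta_\times=(\mathrm{id}_1\otimes\varphi_{1,2}\otimes\mathrm{id}_2)\circ(\Delta_1\otimes\Delta_2)$, $\varepsilon_\times=\varepsilon_1\otimes\varepsilon_2$. This bialgebra is the cross product bialgebra of the BAT. It is called trivalent if at least one of the morphisms $\eta_1\otimes\mathrm{id}_2:B_2\to B_1\otimes B_2$, $\mathrm{id}_1\otimes\eta_2:B_1\to B_1\otimes B_2$, $\varepsilon_1\otimes\mathrm{id}_2:B_1\otimes B_2\to B_2$, $\mathrm{id}_1\otimes\varepsilon_2:B_1\otimes B_2\to B_1$ is both an algebra and a coalgebra morphism. Hopf datum. A Hopf datum $(B_1,B_2,\mu_l,\nu_l,\mu_r,\nu_r)$ consists of objects $B_1,B_2$, each an algebra $(\mathrm m_j,\eta_j)$ and a coalgebra $(\Delta_j,\varepsilon_j)$ such that $\varepsilon_j$ is an algebra morphism and $\eta_j$ is a coalgebra morphism; a left $B_2$-module structure $\mu_l:B_2\otimes B_1\to B_1$ and a left $B_2$-comodule structure $\nu_l:B_1\to B_2\otimes B_1$ on $B_1$; a right $B_1$-module structure $\mu_r:B_2\otimes B_1\to B_2$ and a right $B_1$-comodule structure $\nu_r:B_2\to B_2\otimes B_1$ on $B_2$. Put $\phi_{1,2}=(\mathrm m_2\otimes\mathrm m_1)\circ(\mathrm{id}_2\otimes\Psi_{1,2}\otimes\mathrm{id}_1)\circ(\nu_l\otimes\nu_r)$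 and $\phi_{2,1}=(\mu_l\otimes\mu_r)\circ(\mathrm{id}_2\otimes\Psi_{2,1}\otimes\mathrm{id}_1)\circ(\Delta_2\otimes\Delta_1)$. Required identities: - $\mu_r\circ(\eta_2\otimes\mathrm{id}_1)=\eta_2\circ\varepsilon_1=(\mathrm{id}_2\otimes\varepsilon_1)\circ\nu_l$; $\varepsilon_2\circ\mu_r=\varepsilon_2\otimes\varepsilon_1=\varepsilon_1\circ\mu_l$; $\mu_l\circ(\mathrm{id}_2\otimes\eta_1)=\eta_1\circ\varepsilon_2=(\varepsilon_2\otimes\mathrm{id}_1)\circ\nu_r$; $\nu_r\circ\eta_2=\eta_2\otimes\eta_1=\nu_l\circ\eta_1$. - Algebra-coalgebra: $\Delta_1\mathrm m_1=(\mathrm m_1\otimes\mathrm m_1)\circ(\mathrm{id}_1\otimes\mu_l\otimes\mathrm{id}_1\otimes\mathrm{id}_1)\circ(\mathrm{id}_1\otimes\mathrm{id}_2\otimes\Psi_{1,1}\otimes\mathrm{id}_1)\circ(\mathrm{id}_1\otimes\nu_l\otimes\mathrm{id}_1\otimes\mathrm{id}_1)\circ(\Delta_1\otimes\Delta_1)$ and $\Delta_2\mathrm m_2=(\mathrm m_2\otimes\mathrm m_2)\circ(\mathrm{id}_2\otimes\mathrm{id}_2\otimes\mu_r\otimes\mathrm{id}_2)\circ(\mathrm{id}_2\otimes\Psi_{2,2}\otimes\mathrm{id}_1\otimes\mathrm{id}_2)\circ(\mathrm{id}_2\otimes\mathrm{id}_2\otimes\nu_r\otimes\mathrm{id}_2)\circ(\Delta_2\otimes\Delta_2)$.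 - Module-comodule: $\phi_{1,2}\circ\phi_{2,1}=(\mathrm m_2\otimes\mathrm m_1)\circ(\mu_r\otimes\Psi_{1,2}\otimes\mu_l)\circ(\mathrm{id}_2\otimes\Psi_{1,1}\otimes\Psi_{2,2}\otimes\mathrm{id}_1)\circ(\nu_r\otimes\Psi_{2,1}\otimes\nu_l)\circ(\Delta_2\otimes\Delta_1)$. - Module-algebra: $\mu_r(\mathrm m_2\otimes\mathrm{id}_1)=\mathrm m_2(\mu_r\otimes\mathrm{id}_2)(\mathrm{id}_2\otimes\phi_{2,1})$; $\mu_l(\mathrm{id}_2\otimes\mathrm m_1)=\mathrm m_1(\mathrm{id}_1\otimes\mu_l)(\phi_{2,1}\otimes\mathrm{id}_1)$. - Comodule-coalgebra: $(\Delta_2\otimes\mathrm{id}_1)\nu_r=(\mathrm{id}_2\otimes\phi_{1,2})(\nu_r\otimes\mathrm{id}_2)\Delta_2$; $(\mathrm{id}_2\otimes\Delta_1)\nu_l=(\phi_{1,2}\otimes\mathrm{id}_1)(\mathrm{id}_1\otimes\nu_l)\Delta_1$. - Module-coalgebra: $\Delta_2\mu_r=(\mathrm m_2\otimes\mu_r)(\mu_r\otimes\Psi_{2,2}\otimes\mathrm{id}_1)(\mathrm{id}_2\otimes\Psi_{2,1}\otimes\nu_l)(\Delta_2\otimes\Delta_1)$; $\Delta_1\mu_l=(\mu_l\otimes\mathrm m_1)(\mathrm{id}_2\otimes\Psi_{1,1}\otimes\mu_l)(\nu_r\otimes\Psi_{2,1}\otimes\mathrm{id}_1)(\Delta_2\otimes\Delta_1)$.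 - Comodule-algebra: $\nu_r\mathrm m_2=(\mathrm m_2\otimes\mathrm m_1)(\mathrm{id}_2\otimes\Psi_{1,2}\otimes\mu_l)(\nu_r\otimes\Psi_{2,2}\otimes\mathrm{id}_1)(\Delta_2\otimes\nu_r)$; $\nu_l\mathrm m_1=(\mathrm m_2\otimes\mathrm m_1)(\mu_r\otimes\Psi_{1,2}\otimes\mathrm{id}_1)(\mathrm{id}_2\otimes\Psi_{1,1}\otimes\nu_l)(\nu_l\otimes\Delta_1)$. Trivalent Hopf datum: a Hopf datum in which at least one of the (co)actions is trivial, i.e. $\mu_l=\varepsilon_2\otimes\mathrm{id}_1$, or $\mu_r=\mathrm{id}_2\otimes\varepsilon_1$, or $\nu_l=\eta_2\otimes\mathrm{id}_1$, or $\nu_r=\mathrm{id}_2\otimes\eta_1$. Its corresponding bialgebra is $B=B_1\otimes B_2$ with $\mathrm m_B=(\mathrm m_1\otimes\mathrm m_2)\circ(\mathrm{id}_1\otimes\phi_{2,1}\otimes\mathrm{id}_2)$, $\eta_B=\eta_1\otimes\eta_2$, $\Delta_B=(\mathrm{id}_1\otimes\phi_{1,2}\otimes\mathrm{id}_2)\circ(\Delta_1\otimes\Delta_2)$, $\varepsilon_B=\varepsilon_1\otimes\varepsilon_2$ (this is a bialgebra for every trivalent Hopf datum). *)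

(* Defs.v *)
From mathcomp Require Import ssreflect ssrfun ssrbool eqtype ssrnat seq.

Set Implicit Arguments.
Unset Strict Implicit.
Unset Printing Implicit Defensive.

Declare Scope ob_scope.
Delimit Scope ob_scope with ob.
Declare Scope mor_scope.
Delimit Scope mor_scope with mor.

Reserved Notation "f ∘ g" (at level 40, left associativity).
Reserved Notation "x ⊗ y" (at level 38, left associativity).

(* Mac Lane's definition of a category by a collection of objects and a single
   collection of arrows with domain and codomain.  This lets the strictness
   equations of a monoidal category, f ⊗ (g ⊗ h) = (f ⊗ g) ⊗ h and
   f ⊗ id_I = f, be plain equations between arrows, without transport along
   equalities of objects.  [comp f g], "f after g", is the composite when
   [dom f = cod g]; its value is left unspecified on the other pairs, about
   which no axiom says anything. *)
Record category : Type := Category {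
  Ob : Type;
  Mor : Type;
  dom : Mor -> Ob;
  cod : Mor -> Ob;
  idm : Ob -> Mor;
  comp : Mor -> Mor -> Mor;
  dom_idm : forall a, dom (idm a) = a;
  cod_idm : forall a, cod (idm a) = a;
  dom_comp : forall f g, dom f = cod g -> dom (comp f g) = dom g;
  cod_comp : forall f g, dom f = cod g -> cod (comp f g) = cod f;
  comp_idl : forall f, comp (idm (cod f)) f = f;
  comp_idr : forall f, comp f (idm (dom f)) = f;
  compA : forall f g h, dom f = cod g -> dom g = cod h ->
    comp f (comp g h) = comp (comp f g) h
}.

Bind Scope ob_scope with Ob.
Bind Scope mor_scope with Mor.
Arguments idm {_} _%_ob.
Arguments comp {_} (_ _)%_mor.
Notation "f ∘ g" := (comp f g) : mor_scope.
Local Open Scope mor_scope.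

Definition hom (C : category) (a b : Ob C) (f : Mor C) : Prop :=
  dom f = a /\ cod f = b.

Definition inverse (C : category) (f g : Mor C) : Prop :=
  [/\ dom f = cod g, cod f = dom g, f ∘ g = idm (cod f) & g ∘ f = idm (dom f)].

Record strict_monoidal_category : Type := StrictMonoidalCategory {
  smc_cat :> category;
  unit_ob : Ob smc_cat;
  tensor_ob : Ob smc_cat -> Ob smc_cat -> Ob smc_cat;
  tensor : Mor smc_cat -> Mor smc_cat -> Mor smc_cat;
  dom_tensor : forall f g, dom (tensor f g) = tensor_ob (dom f) (dom g);
  cod_tensor : forall f g, cod (tensor f g) = tensor_ob (cod f) (cod g);
  tensor_idm : forall a b, tensor (idm a) (idm b) = idm (tensor_ob a b);
  tensor_comp : forall f f' g g', dom f = cod f' -> dom g = cod g' ->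
    tensor (f ∘ f') (g ∘ g') = tensor f g ∘ tensor f' g';
  tensor_obA : forall a b c,
    tensor_ob a (tensor_ob b c) = tensor_ob (tensor_ob a b) c;
  tensor_ob1l : forall a, tensor_ob unit_ob a = a;
  tensor_ob1r : forall a, tensor_ob a unit_ob = a;
  tensorA : forall f g h, tensor f (tensor g h) = tensor (tensor f g) h;
  tensor1l : forall f, tensor (idm unit_ob) f = f;
  tensor1r : forall f, tensor f (idm unit_ob) = f
}.

Arguments tensor_ob {_} (_ _)%_ob.
Arguments tensor {_} (_ _)%_mor.
Arguments unit_ob {_}.
Notation "a ⊗ b" := (tensor_ob a b) : ob_scope.
Notation "f ⊗ g" := (tensor f g) : mor_scope.

Record braided_category : Type := BraidedCategory {
  bc_smc :> strict_monoidal_category;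
  Psi : Ob bc_smc -> Ob bc_smc -> Mor bc_smc;
  Psi_hom : forall a b, hom (a ⊗ b) (b ⊗ a) (Psi a b);
  Psi_iso : forall a b, exists g, inverse (Psi a b) g;
  Psi_natural : forall f g,
    Psi (cod f) (cod g) ∘ (f ⊗ g) = (g ⊗ f) ∘ Psi (dom f) (dom g);
  Psi_tensorr : forall a b c,
    Psi a (b ⊗ c) = (idm b ⊗ Psi a c) ∘ (Psi a b ⊗ idm c);
  Psi_tensorl : forall a b c,
    Psi (a ⊗ b) c = (Psi a c ⊗ idm b) ∘ (idm a ⊗ Psi b c)
}.

Section Idempotents.
Variable C : category.
Implicit Types (Pi p i : Mor C) (M N : Ob C).

Definition is_idempotent M Pi : Prop := hom M M Pi /\ Pi ∘ Pi = Pi.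

Definition splitting M N Pi p i : Prop :=
  [/\ hom M N p, hom N M i, p ∘ i = idm N & i ∘ p = Pi].

Definition idempotents_split : Prop :=
  forall M Pi, is_idempotent M Pi -> exists N p i, splitting M N Pi p i.

End Idempotents.

Section Bialgebras.
Variable C : braided_category.

(* Raw data only; the axioms are the predicates [is_algebra], [is_coalgebra]
   and [is_bialgebra] below. *)
Record prebialgebra : Type := Prebialgebra {
  carrier :> Ob C;
  mul : Mor C;
  eta : Mor C;
  Delta : Mor C;
  eps : Mor C
}.

Implicit Types A B : prebialgebra.

Definition is_algebra A : Prop :=
  [/\ hom (A ⊗ A) A (mul A) /\ hom unit_ob A (eta A),
      mul A ∘ (mul A ⊗ idm A) = mul A ∘ (idm A ⊗ mul A),
      mul A ∘ (eta A ⊗ idm A) = idm A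
    & mul A ∘ (idm A ⊗ eta A) = idm A].

Definition is_coalgebra A : Prop :=
  [/\ hom A (A ⊗ A) (Delta A) /\ hom A unit_ob (eps A),
      (Delta A ⊗ idm A) ∘ Delta A = (idm A ⊗ Delta A) ∘ Delta A,
      (eps A ⊗ idm A) ∘ Delta A = idm A
    & (idm A ⊗ eps A) ∘ Delta A = idm A].

Definition algebra_morphism A B (f : Mor C) : Prop :=
  [/\ hom A B f, f ∘ mul A = mul B ∘ (f ⊗ f) & f ∘ eta A = eta B].

Definition coalgebra_morphism A B (f : Mor C) : Prop :=
  [/\ hom A B f, Delta B ∘ f = (f ⊗ f) ∘ Delta A & eps B ∘ f = eps A].

Definition unit_prebialgebra : prebialgebra :=
  Prebialgebra unit_ob (idm unit_ob) (idm unit_ob) (idm unit_ob) (idm unit_ob).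

Definition is_bialgebra A : Prop :=
  [/\ is_algebra A,
      is_coalgebra A,
      Delta A ∘ mul A =
        (mul A ⊗ mul A) ∘ (idm A ⊗ Psi A A ⊗ idm A) ∘ (Delta A ⊗ Delta A),
      algebra_morphism A unit_prebialgebra (eps A)
    & coalgebra_morphism unit_prebialgebra A (eta A)].

Definition bialgebra_morphism A B (f : Mor C) : Prop :=
  algebra_morphism A B f /\ coalgebra_morphism A B f.

Definition bialgebra_isomorphic A B : Prop :=
  exists f g, bialgebra_morphism A B f /\ inverse f g.

Definition cross_product (B1 B2 : prebialgebra) (phi12 phi21 : Mor C) :
    prebialgebra :=
  {| carrier := B1 ⊗ B2;
     mul := (mul B1 ⊗ mul B2) ∘ (idm B1 ⊗ phi21 ⊗ idm B2);
     eta := eta B1 ⊗ eta B2;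
     Delta := (idm B1 ⊗ phi12 ⊗ idm B2) ∘ (Delta B1 ⊗ Delta B2);
     eps := eps B1 ⊗ eps B2 |}.

Record is_BAT (B1 B2 : prebialgebra) (phi12 phi21 : Mor C) : Prop := {
  BAT_algebra1 : is_algebra B1;
  BAT_coalgebra1 : is_coalgebra B1;
  BAT_eps_eta1 : eps B1 ∘ eta B1 = idm unit_ob;
  BAT_algebra2 : is_algebra B2;
  BAT_coalgebra2 : is_coalgebra B2;
  BAT_eps_eta2 : eps B2 ∘ eta B2 = idm unit_ob;
  BAT_phi12 : hom (B1 ⊗ B2) (B2 ⊗ B1) phi12;
  BAT_phi21 : hom (B2 ⊗ B1) (B1 ⊗ B2) phi21;
  BAT_bialgebra : is_bialgebra (cross_product B1 B2 phi12 phi21)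
}.

Definition trivalent_cross_product (B1 B2 : prebialgebra) (phi12 phi21 : Mor C)
    : Prop :=
  let B := cross_product B1 B2 phi12 phi21 in
  [\/ bialgebra_morphism B2 B (eta B1 ⊗ idm B2),
      bialgebra_morphism B1 B (idm B1 ⊗ eta B2),
      bialgebra_morphism B B2 (eps B1 ⊗ idm B2)
    | bialgebra_morphism B B1 (idm B1 ⊗ eps B2)].

Definition left_module (A : prebialgebra) (X : Ob C) (mu : Mor C) : Prop :=
  [/\ hom (A ⊗ X) X mu,
      mu ∘ (mul A ⊗ idm X) = mu ∘ (idm A ⊗ mu)
    & mu ∘ (eta A ⊗ idm X) = idm X].

Definition right_module (A : prebialgebra) (X : Ob C) (mu : Mor C) : Prop :=
  [/\ hom (X ⊗ A) X mu,
      mu ∘ (idm X ⊗ mul A) = mu ∘ (mu ⊗ idm A)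
    & mu ∘ (idm X ⊗ eta A) = idm X].

Definition left_comodule (A : prebialgebra) (X : Ob C) (nu : Mor C) : Prop :=
  [/\ hom X (A ⊗ X) nu,
      (Delta A ⊗ idm X) ∘ nu = (idm A ⊗ nu) ∘ nu
    & (eps A ⊗ idm X) ∘ nu = idm X].

Definition right_comodule (A : prebialgebra) (X : Ob C) (nu : Mor C) : Prop :=
  [/\ hom X (X ⊗ A) nu,
      (idm X ⊗ Delta A) ∘ nu = (nu ⊗ idm A) ∘ nu
    & (idm X ⊗ eps A) ∘ nu = idm X].

Section HopfDatum.
Variables (B1 B2 : prebialgebra) (mu_l nu_l mu_r nu_r : Mor C).

Local Notation id1 := (idm B1).
Local Notation id2 := (idm B2).
Local Notation m1 := (mul B1).
Local Notation m2 := (mul B2).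
Local Notation eta1 := (eta B1).
Local Notation eta2 := (eta B2).
Local Notation Delta1 := (Delta B1).
Local Notation Delta2 := (Delta B2).
Local Notation eps1 := (eps B1).
Local Notation eps2 := (eps B2).
Local Notation Psi11 := (Psi B1 B1).
Local Notation Psi12 := (Psi B1 B2).
Local Notation Psi21 := (Psi B2 B1).
Local Notation Psi22 := (Psi B2 B2).

Definition hd_phi12 : Mor C :=
  (m2 ⊗ m1) ∘ (id2 ⊗ Psi12 ⊗ id1) ∘ (nu_l ⊗ nu_r).

Definition hd_phi21 : Mor C :=
  (mu_l ⊗ mu_r) ∘ (id2 ⊗ Psi21 ⊗ id1) ∘ (Delta2 ⊗ Delta1).

Local Notation phi12 := hd_phi12.
Local Notation phi21 := hd_phi21.

Record is_hopf_datum : Prop := {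
  hd_algebra1 : is_algebra B1;
  hd_coalgebra1 : is_coalgebra B1;
  hd_eps1 : algebra_morphism B1 unit_prebialgebra eps1;
  hd_eta1 : coalgebra_morphism unit_prebialgebra B1 eta1;
  hd_algebra2 : is_algebra B2;
  hd_coalgebra2 : is_coalgebra B2;
  hd_eps2 : algebra_morphism B2 unit_prebialgebra eps2;
  hd_eta2 : coalgebra_morphism unit_prebialgebra B2 eta2;

  hd_mu_l : left_module B2 B1 mu_l;
  hd_nu_l : left_comodule B2 B1 nu_l;
  hd_mu_r : right_module B1 B2 mu_r;
  hd_nu_r : right_comodule B1 B2 nu_r;

  hd_mu_r_eta : mu_r ∘ (eta2 ⊗ id1) = eta2 ∘ eps1;
  hd_nu_l_eps : eta2 ∘ eps1 = (id2 ⊗ eps1) ∘ nu_l;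
  hd_eps_mu_r : eps2 ∘ mu_r = eps2 ⊗ eps1;
  hd_eps_mu_l : eps2 ⊗ eps1 = eps1 ∘ mu_l;
  hd_mu_l_eta : mu_l ∘ (id2 ⊗ eta1) = eta1 ∘ eps2;
  hd_nu_r_eps : eta1 ∘ eps2 = (eps2 ⊗ id1) ∘ nu_r;
  hd_nu_r_eta : nu_r ∘ eta2 = eta2 ⊗ eta1;
  hd_nu_l_eta : eta2 ⊗ eta1 = nu_l ∘ eta1;

  hd_algebra_coalgebra1 :
    Delta1 ∘ m1 =
      (m1 ⊗ m1) ∘ (id1 ⊗ mu_l ⊗ id1 ⊗ id1) ∘ (id1 ⊗ id2 ⊗ Psi11 ⊗ id1)
        ∘ (id1 ⊗ nu_l ⊗ id1 ⊗ id1) ∘ (Delta1 ⊗ Delta1);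
  hd_algebra_coalgebra2 :
    Delta2 ∘ m2 =
      (m2 ⊗ m2) ∘ (id2 ⊗ id2 ⊗ mu_r ⊗ id2) ∘ (id2 ⊗ Psi22 ⊗ id1 ⊗ id2)
        ∘ (id2 ⊗ id2 ⊗ nu_r ⊗ id2) ∘ (Delta2 ⊗ Delta2);

  hd_module_comodule :
    phi12 ∘ phi21 =
      (m2 ⊗ m1) ∘ (mu_r ⊗ Psi12 ⊗ mu_l) ∘ (id2 ⊗ Psi11 ⊗ Psi22 ⊗ id1)
        ∘ (nu_r ⊗ Psi21 ⊗ nu_l) ∘ (Delta2 ⊗ Delta1);

  hd_module_algebra_r :
    mu_r ∘ (m2 ⊗ id1) = m2 ∘ (mu_r ⊗ id2) ∘ (id2 ⊗ phi21);
  hd_module_algebra_l :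
    mu_l ∘ (id2 ⊗ m1) = m1 ∘ (id1 ⊗ mu_l) ∘ (phi21 ⊗ id1);

  hd_comodule_coalgebra_r :
    (Delta2 ⊗ id1) ∘ nu_r = (id2 ⊗ phi12) ∘ (nu_r ⊗ id2) ∘ Delta2;
  hd_comodule_coalgebra_l :
    (id2 ⊗ Delta1) ∘ nu_l = (phi12 ⊗ id1) ∘ (id1 ⊗ nu_l) ∘ Delta1;

  hd_module_coalgebra_r :
    Delta2 ∘ mu_r =
      (m2 ⊗ mu_r) ∘ (mu_r ⊗ Psi22 ⊗ id1) ∘ (id2 ⊗ Psi21 ⊗ nu_l)
        ∘ (Delta2 ⊗ Delta1);
  hd_module_coalgebra_l :
    Delta1 ∘ mu_l =
      (mu_l ⊗ m1) ∘ (id2 ⊗ Psi11 ⊗ mu_l) ∘ (nu_r ⊗ Psi21 ⊗ id1)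
        ∘ (Delta2 ⊗ Delta1);

  hd_comodule_algebra_r :
    nu_r ∘ m2 =
      (m2 ⊗ m1) ∘ (id2 ⊗ Psi12 ⊗ mu_l) ∘ (nu_r ⊗ Psi22 ⊗ id1)
        ∘ (Delta2 ⊗ nu_r);
  hd_comodule_algebra_l :
    nu_l ∘ m1 =
      (m2 ⊗ m1) ∘ (mu_r ⊗ Psi12 ⊗ id1) ∘ (id2 ⊗ Psi11 ⊗ nu_l)
        ∘ (nu_l ⊗ Delta1)
}.

Definition trivalent_hopf_datum : Prop :=
  is_hopf_datum /\
  [\/ mu_l = eps2 ⊗ id1, mu_r = id2 ⊗ eps1, nu_l = eta2 ⊗ id1
    | nu_r = id2 ⊗ eta1].

Definition hopf_datum_bialgebra : prebialgebra :=
  cross_product B1 B2 phi12 phi21.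

End HopfDatum.

End Bialgebras.

Arguments unit_prebialgebra {C}.

(* Main.v *)
Require Import Defs.
From mathcomp Require Import ssreflect ssrfun ssrbool eqtype ssrnat seq.

(* Call factorization of A morphisms i_j : B_j -> A and p_j : A -> B_j as in (3),
   without the last condition. Since m_A (i_1 ⊗ i_2) and (p_1 ⊗ p_2) Δ_A are
   inverse to each other, one has p_1 m_A (i_1 ⊗ id) = m_1 (id ⊗ p_1) and
   p_1 m_A = p_1 m_A (id ⊗ i_1 p_1), hence, with mu_l = p_1 m_A (i_2 ⊗ i_1),
     p_1 m_A = m_1 (id ⊗ mu_l) (p_1 ⊗ p_2 ⊗ id) (Δ_A ⊗ p_1).
   This formula, its mirror image and their duals turn the compatibility of Δ_A and
   m_A into the axioms of a Hopf datum, with no triviality assumption.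
   Triviality is needed for the converse: that B_1 ⊗ B_2 is a bialgebra. Passing to
   the opposite category exchanges the actions with the coactions, reversing the
   tensor product exchanges left and right, so that one may assume mu_r trivial.
   Then the twists phi_12 and phi_21 satisfy the distributivity laws, which give
   associativity and coassociativity, and Δ_B is multiplicative because it is so on
   the four kinds of products of an element of a factor by an element of a factor.

   Identities between string diagrams are proved by reflection: a diagram is a
   sequence of elementary layers, kept in a normal form for the interchange law, and
   a proof lists the layers to be rewritten, on both sides, until they coincide. *)

Set Implicit Arguments.
Unset Strict Implicit.
Unset Printing Implicit Defensive.

Local Open Scope mor_scope.

(** * String diagrams *)

(** Composition is total on arrows but obeys its laws only on composable pairs, so each use of
    associativity or interchange by hand would carry typing side conditions. In the reflected form
    objects are words of wires, typing is decided by computation, and these laws are absorbed by the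
    normal form. The alternatives in the four statements correspond one by one: mu_l trivial, p_1 a
    bialgebra morphism, Π_1 multiplicative; nu_l trivial, i_1 a bialgebra morphism, Π_1
    comultiplicative; and the same with mu_r, nu_r for the index 2. Each implication of the cycle
    preserves this correspondence, so the trivial (co)action is never chosen anew. *)

Inductive oexpr := OUnit | OVar of nat | OTens of oexpr & oexpr.

Inductive expr :=
  | EId of oexpr | EPsi of oexpr & oexpr | EGen of nat
  | EComp of expr & expr | ETens of expr & expr.

(* A generator, or the crossing of two wires. *)
Definition node := (nat + nat * nat)%type.
Definition layer := (seq nat * node * seq nat)%type.
Definition signature := seq (oexpr * oexpr).

Fixpoint oflat o : seq nat :=
  match o with OUnit => [::] | OVar n => [:: n] | OTens a b => oflat a ++ oflat b end.

Section Syntax.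
Variable sigs : signature.

Definition nin (g : node) : seq nat :=
  match g with inl n => oflat (nth (OUnit, OUnit) sigs n).1 | inr (a, b) => [:: a; b] end.
Definition nout (g : node) : seq nat :=
  match g with inl n => oflat (nth (OUnit, OUnit) sigs n).2 | inr (a, b) => [:: b; a] end.

Definition lin (x : layer) := let: (l, g, r) := x in l ++ nin g ++ r.
Definition lout (x : layer) := let: (l, g, r) := x in l ++ nout g ++ r.

(* A layer [(l, g, r)] stands for id_l ⊗ g ⊗ id_r; a diagram is the sequence of
   its layers, in the order of composition: the last arrow comes first. *)
Fixpoint tgt (w : seq nat) (d : seq layer) : option (seq nat) :=
  if d is x :: d' then if tgt w d' == Some (lin x) then Some (lout x) else None
  else Some w.

Definition shift (l r : seq nat) (x : layer) : layer :=
  let: (a, g, b) := x in (l ++ a, g, b ++ r).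

(** The two hexagon identities break the braiding of two words into crossings of single wires; the
    layers come in the order of [Psi_tensorr] here and of [Psi_tensorl] in [cross]. *)
Fixpoint cross1 (a : nat) (w : seq nat) : seq layer :=
  if w is b :: w' then
    map (shift [:: b] [::]) (cross1 a w') ++ [:: ([::], inr (a, b), w')]
  else [::].
Fixpoint cross (v w : seq nat) : seq layer :=
  if v is a :: v' then
    map (shift [::] v') (cross1 a w) ++ map (shift [:: a] [::]) (cross v' w)
  else [::].

(** Types are flattened to words: in a strict category all bracketings and all tensor products with
    the unit then agree, and composability is an equality test on lists. *)
Fixpoint ety (e : expr) : option (seq nat * seq nat) :=
  match e with
  | EId o => Some (oflat o, oflat o)
  | EPsi a b => Some (oflat a ++ oflat b, oflat b ++ oflat a)
  | EGen n => let s := nth (OUnit, OUnit) sigs n in Some (oflat s.1, oflat s.2)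
  | EComp f g =>
    if ety f is Some (b, c) then
      if ety g is Some (a, b') then if b == b' then Some (a, c) else None
      else None
    else None
  | ETens f g =>
    if ety f is Some (a, b) then
      if ety g is Some (c, d) then Some (a ++ c, b ++ d) else None
    else None
  end.

Definition edom e := if ety e is Some (a, _) then a else [::].
Definition ecod e := if ety e is Some (_, b) then b else [::].

Fixpoint flat (e : expr) : seq layer :=
  match e with
  | EId _ => [::]
  | EPsi a b => cross (oflat a) (oflat b)
  | EGen n => [:: ([::], inl n, [::])]
  | EComp f g => flat f ++ flat g
  | ETens f g =>
    map (shift [::] (ecod g)) (flat f) ++ map (shift (edom f) [::]) (flat g)
  end.

(* [swap_left x y]: the arrow of [x], applied after [y], acts to the left of the
   arrow of [y], so that it can be applied first; [swap_right] is the mirror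
   image. *)
Definition swap_left (x y : layer) : option (layer * layer) :=
  let: (l2, g2, r2) := x in let: (l1, g1, r1) := y in
  let m := drop (size (l2 ++ nin g2)) l1 in
  if (l1 == l2 ++ nin g2 ++ m) && (r2 == m ++ nout g1 ++ r1)
  then Some ((l2 ++ nout g2 ++ m, g1, r1), (l2, g2, m ++ nin g1 ++ r1))
  else None.
Definition swap_right (x y : layer) : option (layer * layer) :=
  let: (l2, g2, r2) := x in let: (l1, g1, r1) := y in
  let m := drop (size (l1 ++ nout g1)) l2 in
  if (l2 == l1 ++ nout g1 ++ m) && (r1 == m ++ nin g2 ++ r2)
  then Some ((l1, g1, m ++ nout g2 ++ r2), (l1 ++ nin g1 ++ m, g2, r2))
  else None.
Definition swap x y :=
  if swap_left x y is Some p then Some p else swap_right x y.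

(** Insertion sort: a layer moves towards the start of the composition as long as it acts to the
    left of the layer that it meets. Only preservation of the meaning is proved, in [eqd_canon];
    uniqueness of the resulting form is never assumed. *)
Fixpoint insert (x : layer) (d : seq layer) : seq layer :=
  if d is y :: d' then
    if swap_left x y is Some (y', x') then y' :: insert x' d' else x :: d
  else [:: x].
Definition canon (d : seq layer) := foldr insert [::] d.

Fixpoint pass (x : layer) (d : seq layer) : option (seq layer * layer) :=
  if d is y :: d' then
    if swap x y is Some (y', x') then
      if pass x' d' is Some (d'', x'') then Some (y' :: d'', x'') else None
    else None
  else Some ([::], x).

(* Brings together the layers of index in [js], by interchange: each of the other
   layers goes to [pre] if it can be applied before them, to [post] otherwise. *)
Fixpoint gather (js : seq nat) (i : nat) (d : seq layer) :
    seq layer * seq layer * seq layer :=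
  if d is x :: d' then
    let: (post, block, pre) := gather js i.+1 d' in
    let stay := (x :: post, block, pre) in
    if pass x post is Some (post', x') then
      if i \in js then (post', x' :: block, pre)
      else if pass x' block is Some (block', x'') then (post', block', x'' :: pre)
      else stay
    else stay
  else ([::], [::], [::]).

Definition rule := (expr * expr)%type.

Definition is_rule (R : rule) :=
  if ety R.1 is Some t then ety R.2 == Some t else false.

(** The offset [k] counts the wires to the left of the block. Without a match, or when the two sides
    of the rule have different types, the block is left alone: a wrong script can make [check] fail,
    but cannot prove a false equation. *)
Definition rewrite_block (w : seq nat) (R : rule) (ks : seq nat) (block pre : seq layer) :=
  let lhs := canon (flat R.1) in
  let v := odflt [::] (tgt w pre) in
  let s := edom R.1 in
  let ctx k := (take k v, drop (k + size s) v) in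
  let fits k := (v == (ctx k).1 ++ s ++ (ctx k).2) &&
    (canon block == canon (map (shift (ctx k).1 (ctx k).2) lhs)) in
  if filter fits ks is k :: _ then
    if is_rule R then map (shift (ctx k).1 (ctx k).2) (flat R.2) else block
  else block.

(* [Ax n] is the [n]-th equation, [NatL] and [NatR] the naturality of the braiding
   in its left and right argument. [Rw] and [RwR] rewrite the layers of the given
   indices with an equation, read from left to right and from right to left. [Ins]
   and [InsR] do so when the side to be replaced is an identity; the place is
   given by the number of layers above it and of wires to its left. *)
Inductive ruleref := Ax of nat | NatL of expr & nat | NatR of nat & expr.
Coercion Ax : nat >-> ruleref.

Inductive step :=
  | Rw of ruleref & seq nat | RwR of ruleref & seq nat
  | Ins of ruleref & nat & nat | InsR of ruleref & nat & nat.

Definition owires (w : seq nat) := foldr (fun n => OTens (OVar n)) OUnit w.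
Definition psi_rule_l (e : expr) (c : nat) : rule :=
  (EComp (EPsi (owires (ecod e)) (OVar c)) (ETens e (EId (OVar c))),
   EComp (ETens (EId (OVar c)) e) (EPsi (owires (edom e)) (OVar c))).
Definition psi_rule_r (c : nat) (e : expr) : rule :=
  (EComp (EPsi (OVar c) (owires (ecod e))) (ETens (EId (OVar c)) e),
   EComp (ETens e (EId (OVar c))) (EPsi (OVar c) (owires (edom e)))).

Variable rules : seq rule.

(** Numbers out of range and ill-typed expressions yield a trivial rule, so that every reference
    denotes a valid equation ([get_ruleP]). *)
Definition get_rule (r : ruleref) : rule :=
  match r with
  | Ax n => nth (EId OUnit, EId OUnit) rules n
  | NatL e c => if ety e is Some _ then psi_rule_l e c else (e, e)
  | NatR c e => if ety e is Some _ then psi_rule_r c e else (e, e)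
  end.

Definition rev_rule (R : rule) : rule := (R.2, R.1).

Definition rw_at w R js d :=
  let: (post, block, pre) := gather js 0 d in
  canon (post ++ rewrite_block w R (iota 0 (size (odflt [::] (tgt w pre))).+1)
                   block pre ++ pre).
Definition ins_at w R i k d :=
  canon (take i d ++ rewrite_block w R [:: k] [::] (drop i d) ++ drop i d).

Definition do_step w (s : step) (d : seq layer) : seq layer :=
  match s with
  | Rw r js => rw_at w (get_rule r) js d
  | RwR r js => rw_at w (rev_rule (get_rule r)) js d
  | Ins r i k => ins_at w (get_rule r) i k d
  | InsR r i k => ins_at w (rev_rule (get_rule r)) i k d
  end.

Definition run w (s : seq step) (d : seq layer) :=
  foldl (fun d s => do_step w s d) (canon d) s.

Definition check (e1 e2 : expr) (s1 s2 : seq step) :=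
  if ety e1 is Some (w, v) then
    (ety e2 == Some (w, v)) && (run w s1 (flat e1) == run w s2 (flat e2))
  else false.

End Syntax.

(** * Meaning of diagrams and soundness of the rewriting *)

Section Semantics.
Variable C : braided_category.
Implicit Types (f g h : Mor C) (a b c : Ob C).

Lemma hom_idm a : hom a a (idm a).
Proof. by split; [exact: dom_idm|exact: cod_idm]. Qed.

Lemma hom_comp a b c f g : hom b c f -> hom a b g -> hom a c (f ∘ g).
Proof.
move=> [df cf] [dg cg]; have e : dom f = cod g by rewrite df cg.
by split; rewrite ?dom_comp ?cod_comp.
Qed.

Lemma hom_tensor a b c d f g : hom a b f -> hom c d g -> hom (a ⊗ c) (b ⊗ d) (f ⊗ g).
Proof. by move=> [<- <-] [<- <-]; split; rewrite ?dom_tensor ?cod_tensor. Qed.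

Lemma comp_idL a b f : hom a b f -> idm b ∘ f = f.
Proof. by move=> [_ <-]; exact: comp_idl. Qed.

Lemma comp_idR a b f : hom a b f -> f ∘ idm a = f.
Proof. by move=> [<- _]; exact: comp_idr. Qed.

Lemma comp_assoc a b c d f g h : hom c d f -> hom b c g -> hom a b h ->
  f ∘ (g ∘ h) = f ∘ g ∘ h.
Proof. by move=> [df _] [dg cg] [_ ch]; apply: Defs.compA; rewrite ?df ?dg. Qed.

Lemma tensorC a b c a' b' c' f g f' g' : hom b c f -> hom a b g ->
  hom b' c' f' -> hom a' b' g' -> (f ∘ g) ⊗ (f' ∘ g') = (f ⊗ f') ∘ (g ⊗ g').
Proof. by move=> [df _] [_ cg] [df' _] [_ cg']; apply: tensor_comp; rewrite ?df ?df'. Qed.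

Lemma tensor_id_comp a b c d f g : hom b c f -> hom a b g ->
  idm d ⊗ (f ∘ g) = (idm d ⊗ f) ∘ (idm d ⊗ g).
Proof.
move=> hf hg; rewrite -(tensorC (hom_idm d) (hom_idm d) hf hg).
by rewrite (comp_idL (hom_idm d)).
Qed.

Lemma tensor_comp_id a b c d f g : hom b c f -> hom a b g ->
  (f ∘ g) ⊗ idm d = (f ⊗ idm d) ∘ (g ⊗ idm d).
Proof.
move=> hf hg; rewrite -(tensorC hf hg (hom_idm d) (hom_idm d)).
by rewrite (comp_idL (hom_idm d)).
Qed.

Lemma tensor_split a b a' b' f g : hom a b f -> hom a' b' g ->
  (f ⊗ idm b') ∘ (idm a ⊗ g) = f ⊗ g.
Proof.
move=> hf hg; rewrite -(tensorC hf (hom_idm a) (hom_idm b') hg).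
by rewrite (comp_idR hf) (comp_idL hg).
Qed.

Lemma tensor_split' a b a' b' f g : hom a b f -> hom a' b' g ->
  (idm b ⊗ g) ∘ (f ⊗ idm a') = f ⊗ g.
Proof.
move=> hf hg; rewrite -(tensorC (hom_idm b) hf hg (hom_idm a')).
by rewrite (comp_idL hf) (comp_idR hg).
Qed.

Lemma Psi_nat a b a' b' f g : hom a b f -> hom a' b' g ->
  Psi b b' ∘ (f ⊗ g) = (g ⊗ f) ∘ Psi a a'.
Proof. by move=> [<- <-] [<- <-]; exact: Psi_natural. Qed.

(** Yields the unit laws of the braiding, which are not among the axioms: the hexagons at the unit
    object make [Psi unit_ob a] and [Psi a unit_ob] idempotent, and both are invertible. *)
Lemma idempotent_iso a f : hom a a f -> (exists g, inverse f g) ->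
  f ∘ f = f -> f = idm a.
Proof.
move=> hf [g [e1 e2 _ gf]] ff; have [df cf] := hf.
have hg : hom a a g by split; rewrite -?e1 -?e2.
have := comp_assoc hg hf hf.
by rewrite ff gf df (comp_idL hf) => <-.
Qed.

Lemma Psi_unitl a : Psi unit_ob a = idm a.
Proof.
apply: idempotent_iso; last 1 first.
- by rewrite -{3}(tensor_ob1l (unit_ob : Ob C)) Psi_tensorl tensor1l tensor1r.
- by have := Psi_hom (unit_ob : Ob C) a; rewrite tensor_ob1l tensor_ob1r.
- exact: Psi_iso.
Qed.

Lemma Psi_unitr a : Psi a unit_ob = idm a.
Proof.
apply: idempotent_iso; last 1 first.
- by rewrite -{3}(tensor_ob1l (unit_ob : Ob C)) Psi_tensorr tensor1l tensor1r.
- by have := Psi_hom a (unit_ob : Ob C); rewrite tensor_ob1l tensor_ob1r.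
- exact: Psi_iso.
Qed.

Variables (obs : seq (Ob C)) (gens : seq (Mor C)) (sigs : signature).

Definition wire n := nth unit_ob obs n.
Fixpoint wires (w : seq nat) : Ob C :=
  if w is n :: w' then wire n ⊗ wires w' else unit_ob.

Lemma wires1 n : wires [:: n] = wire n.
Proof. exact: tensor_ob1r. Qed.

Lemma wires_cat v w : wires (v ++ w) = (wires v ⊗ wires w)%ob.
Proof. by elim: v => [|n v IH] /=; rewrite ?tensor_ob1l // IH tensor_obA. Qed.

Fixpoint odenote (o : oexpr) : Ob C :=
  match o with
  | OUnit => unit_ob | OVar n => wire n | OTens a b => odenote a ⊗ odenote b
  end.

Lemma odenoteE o : odenote o = wires (oflat o).
Proof.
by elim: o => [|n|a IHa b IHb] //=; rewrite ?tensor_ob1r // IHa IHb wires_cat.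
Qed.

Fixpoint denote (e : expr) : Mor C :=
  match e with
  | EId o => idm (odenote o)
  | EPsi a b => Psi (odenote a) (odenote b)
  | EGen n => nth (idm unit_ob) gens n
  | EComp f g => denote f ∘ denote g
  | ETens f g => denote f ⊗ denote g
  end.

Fixpoint typed (gs : seq (Mor C)) (ss : signature) : Prop :=
  match gs, ss with
  | g :: gs', (a, b) :: ss' => hom (odenote a) (odenote b) g /\ typed gs' ss'
  | [::], [::] => True
  | _, _ => False
  end.

Hypothesis gens_typed : typed gens sigs.

(** True out of range as well, because the default arrow, the identity of the unit, has the default
    signature. *)
Lemma hom_gen n : let s := nth (OUnit, OUnit) sigs n in
  hom (odenote s.1) (odenote s.2) (nth (idm unit_ob) gens n).
Proof.
elim: gens sigs gens_typed n => [|g gs IH] [|[a b] ss] //=.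
  by move=> _ n; rewrite !nth_nil; exact: hom_idm.
by move=> [hg hs] [|n] //=; exact: IH.
Qed.

Definition nsem (g : node) : Mor C :=
  match g with
  | inl n => nth (idm unit_ob) gens n
  | inr (a, b) => Psi (wire a) (wire b)
  end.

Local Notation nin := (nin sigs).
Local Notation nout := (nout sigs).
Local Notation lin := (lin sigs).
Local Notation lout := (lout sigs).
Local Notation tgt := (tgt sigs).

Lemma hom_nsem (g : node) : hom (wires (nin g)) (wires (nout g)) (nsem g).
Proof.
case: g => [n|[a b]] /=; last by rewrite !tensor_ob1r; exact: Psi_hom.
by rewrite -!odenoteE; exact: hom_gen.
Qed.

Definition lsem (x : layer) : Mor C :=
  let: (l, g, r) := x in idm (wires l) ⊗ nsem g ⊗ idm (wires r).

Lemma hom_lsem x : hom (wires (lin x)) (wires (lout x)) (lsem x).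
Proof.
case: x => [[l g] r] /=; rewrite !wires_cat !tensor_obA.
by do 2?apply: hom_tensor; try exact: hom_idm; exact: hom_nsem.
Qed.

Fixpoint sem (w : seq nat) (d : seq layer) : Mor C :=
  if d is x :: d' then lsem x ∘ sem w d' else idm (wires w).

Lemma hom_sem w d v : tgt w d = Some v -> hom (wires w) (wires v) (sem w d).
Proof.
elim: d v => [|x d IH] v /=; first by case=> <-; exact: hom_idm.
case: eqP => // /IH h [<-]; exact: hom_comp (hom_lsem x) h.
Qed.

Lemma tgt_cat w d1 d2 v : tgt w (d2 ++ d1) = Some v ->
  exists2 u, tgt w d1 = Some u & tgt u d2 = Some v.
Proof.
elim: d2 v => [|x d2 IH] v /=; first by move=> e; exists v.
by case: eqP => // /IH[u e1 e2] [<-]; exists u => //=; rewrite e2 eqxx.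
Qed.

Lemma sem_cat w d1 d2 u v : tgt w d1 = Some u -> tgt u d2 = Some v ->
  tgt w (d2 ++ d1) = Some v /\ sem w (d2 ++ d1) = sem u d2 ∘ sem w d1.
Proof.
move=> e1; elim: d2 v => [|x d2 IH] v /=.
  by case=> <-; rewrite (comp_idL (hom_sem e1)).
case: eqP => // e [<-]; have [-> ->] := IH _ e; rewrite eqxx; split=> //.
exact: comp_assoc (hom_lsem x) (hom_sem e) (hom_sem e1).
Qed.

(** One-sided on purpose: [d'] has to be well typed only if [d] is. Typing is thus checked once, on
    the initial diagram, and inherited by all later ones. *)
Definition eqd w d d' :=
  forall v, tgt w d = Some v -> tgt w d' = Some v /\ sem w d' = sem w d.

Lemma eqd_trans w d1 d2 d3 : eqd w d1 d2 -> eqd w d2 d3 -> eqd w d1 d3.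
Proof. by move=> h1 h2 v /h1[/h2[-> ->] ->]. Qed.

Arguments eqd_trans [w d1 d2 d3] _ _ v _.

Lemma eqd_cat w d d' e e' : eqd w d d' ->
  (forall u, tgt w d = Some u -> eqd u e e') -> eqd w (e ++ d) (e' ++ d').
Proof.
move=> hd he v /tgt_cat[u e1 e2].
have [e1' s1] := hd _ e1; have [e2' s2] := he _ e1 _ e2.
have [_ ->] := sem_cat e1 e2; have [-> ->] := sem_cat e1' e2'.
by rewrite s1 s2.
Qed.

Lemma eqd_cons w x d d' : eqd w d d' -> eqd w (x :: d) (x :: d').
Proof. by move=> h; apply: (@eqd_cat _ _ _ [:: x] [:: x]). Qed.

Arguments eqd_cons [w x d d'] _ v _.

Lemma sem2 w x y v : tgt w [:: x; y] = Some v ->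
  [/\ w = lin y, lin x = lout y, v = lout x & sem w [:: x; y] = lsem x ∘ lsem y].
Proof.
rewrite /=; case: (Some w =P _) => // -[->]; case: eqP => // -[<-] [<-]; split=> //.
by rewrite (comp_idR (hom_lsem y)).
Qed.

Lemma tgt2 w x y : w = lin y -> lin x = lout y ->
  tgt w [:: x; y] = Some (lout x) /\ sem w [:: x; y] = lsem x ∘ lsem y.
Proof. by move=> -> /= ->; rewrite !eqxx (comp_idR (hom_lsem y)). Qed.

Lemma interchange l (g : node) m (h : node) r :
  let f := idm (wires l) ⊗ nsem g ⊗ idm (wires m) ⊗ nsem h ⊗ idm (wires r) in
  lsem (l ++ nout g ++ m, h, r) ∘ lsem (l, g, m ++ nin h ++ r) = f /\
  lsem (l, g, m ++ nout h ++ r) ∘ lsem (l ++ nin g ++ m, h, r) = f.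
Proof.
have hl : hom (wires (l ++ nin g ++ m)) (wires (l ++ nout g ++ m))
   (idm (wires l) ⊗ nsem g ⊗ idm (wires m)) := hom_lsem (l, g, m).
have hr : hom (wires (nin h ++ r)) (wires (nout h ++ r)) (nsem h ⊗ idm (wires r)).
  by have := hom_lsem ([::], h, r); rewrite /= tensor1l.
have := (tensor_split hl hr, tensor_split' hl hr).
by rewrite /= !(wires_cat m) -!tensor_idm !tensorA => -[].
Qed.

Lemma eqd_swap_left w x y x' y' : swap_left sigs x y = Some (y', x') ->
  eqd w [:: x; y] [:: y'; x'].
Proof.
case: x y => [[l2 g2] r2] [[l1 g1] r1] /=; set m := drop _ _.
case: ifP => // /andP[/eqP-> /eqP->] [<- <-] v /sem2[-> _ -> ->].
have [I1 I2] := interchange l2 g2 m g1 r1; rewrite I2 -I1.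
have [||-> ->] := tgt2 (w := lin (l2 ++ nin g2 ++ m, g1, r1))
  (x := (l2 ++ nout g2 ++ m, g1, r1)) (y := (l2, g2, m ++ nin g1 ++ r1));
  by rewrite //= -?catA.
Qed.

Lemma eqd_swap w x y x' y' : swap sigs x y = Some (y', x') ->
  eqd w [:: x; y] [:: y'; x'].
Proof.
rewrite /swap; case e: swap_left => [p|]; first by case=> ep; apply: eqd_swap_left; rewrite e ep.
case: x y {e} => [[l2 g2] r2] [[l1 g1] r1] /=; set m := drop _ _.
case: ifP => // /andP[/eqP-> /eqP->] [<- <-] v /sem2[-> _ -> ->].
have [I1 I2] := interchange l1 g1 m g2 r2; rewrite I1 -I2.
have [||-> ->] := tgt2 (w := lin (l1, g1, m ++ nin g2 ++ r2))
  (x := (l1, g1, m ++ nout g2 ++ r2)) (y := (l1 ++ nin g1 ++ m, g2, r2));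
  by rewrite //= -?catA.
Qed.

Lemma eqd_insert w x d : eqd w (x :: d) (insert sigs x d).
Proof.
elim: d x => [|y d IH] x //=.
case e: swap_left => [[y' x']|] //.
refine (eqd_trans _ (eqd_cons (IH x'))).
by apply: (@eqd_cat _ d d [:: x; y] [:: y'; x']) => // u _; exact: eqd_swap_left.
Qed.

Arguments eqd_insert [w x d] v _.

Lemma eqd_canon w d : eqd w d (canon sigs d).
Proof.
elim: d => [|x d IH] //=.
exact (eqd_trans (eqd_cons IH) (@eqd_insert _ _ _)).
Qed.

Arguments eqd_canon [w d] v _.

Lemma eqd_pass w x d d' x' : pass sigs x d = Some (d', x') ->
  eqd w (x :: d) (d' ++ [:: x']).
Proof.
elim: d x d' x' => [|y d IH] x d' x' /=; first by case=> <- <-.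
case e: swap => [[y1 x1]|] //; case e': pass => [[d2 x2]|] // [<- <-] /=.
refine (eqd_trans _ (eqd_cons (IH _ _ _ e'))).
by apply: (@eqd_cat _ d d [:: x; y] [:: y1; x1]) => // u _; exact: eqd_swap.
Qed.

Lemma eqd_gather w js i d : let: (post, block, pre) := gather sigs js i d in
  eqd w d (post ++ block ++ pre).
Proof.
elim: d i => [|x d IH] i //=.
have := IH i.+1; case: gather => [[post block] pre] hd.
have stay : eqd w (x :: d) (x :: post ++ block ++ pre) by exact: eqd_cons.
case e: pass => [[post' x']|] //.
have stay' : eqd w (x :: d) (post' ++ x' :: block ++ pre).
  refine (eqd_trans stay _); rewrite -cat_cons -[x' :: _]cat1s [in X in eqd _ _ X]catA.
  by apply: eqd_cat => // u _; apply: eqd_pass e.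
case: ifP => _ //; case e': pass => [[block' x'']|] //.
refine (eqd_trans stay' _); apply: eqd_cat => //.
rewrite -cat_cons -[x'' :: _]cat1s [in X in eqd _ _ X]catA.
by apply: eqd_cat => // u _; apply: eqd_pass e'.
Qed.

Lemma lsem_shift l r x : lsem (shift l r x) = idm (wires l) ⊗ lsem x ⊗ idm (wires r).
Proof.
by case: x => [[a g] b] /=; rewrite !wires_cat -!tensor_idm !tensorA.
Qed.

Lemma lin_shift l r x : lin (shift l r x) = l ++ lin x ++ r.
Proof. by case: x => [[a g] b] /=; rewrite -!catA. Qed.

Lemma lout_shift l r x : lout (shift l r x) = l ++ lout x ++ r.
Proof. by case: x => [[a g] b] /=; rewrite -!catA. Qed.

Lemma sem_shift l r w d v : tgt w d = Some v ->
  tgt (l ++ w ++ r) (map (shift l r) d) = Some (l ++ v ++ r) /\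
  sem (l ++ w ++ r) (map (shift l r) d) = idm (wires l) ⊗ sem w d ⊗ idm (wires r).
Proof.
elim: d v => [|x d IH] v /=.
  by case=> ->; rewrite !wires_cat -!tensor_idm !tensorA.
case: eqP => // e [<-]; have [-> ->] := IH _ e.
rewrite lin_shift lout_shift eqxx lsem_shift; split=> //.
have hx := hom_lsem x; have hd := hom_sem e.
have hl := hom_idm (wires l).
rewrite (tensor_id_comp _ hx hd) (tensor_comp_id _ (b := (wires l ⊗ wires (lin x))%ob)
  (a := (wires l ⊗ wires w)%ob) (c := (wires l ⊗ wires (lout x))%ob)) //;
  exact: hom_tensor.
Qed.

Lemma sem_shiftl l w d v : tgt w d = Some v ->
  tgt (l ++ w) (map (shift l [::]) d) = Some (l ++ v) /\
  sem (l ++ w) (map (shift l [::]) d) = idm (wires l) ⊗ sem w d.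
Proof. by move=> /(sem_shift l [::]); rewrite !cats0 /= tensor1r. Qed.

Lemma sem_shiftr r w d v : tgt w d = Some v ->
  tgt (w ++ r) (map (shift [::] r) d) = Some (v ++ r) /\
  sem (w ++ r) (map (shift [::] r) d) = sem w d ⊗ idm (wires r).
Proof. by move=> /(sem_shift [::] r); rewrite /= tensor1l. Qed.

Lemma sem_cross1 (a : nat) w : tgt (a :: w) (cross1 a w) = Some (w ++ [:: a]) /\
  sem (a :: w) (cross1 a w) = Psi (wire a) (wires w).
Proof.
elim: w => [|b w [IHt IHs]] /=; first by rewrite Psi_unitr tensor_ob1r.
have h : tgt [:: a, b & w] [:: ([::], inr (a, b), w)] = Some [:: b, a & w].
  by rewrite /= eqxx.
have [e1 e2] := sem_shiftl [:: b] IHt.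
have [-> ->] := sem_cat h e1; split=> //.
rewrite e2 IHs wires1 Psi_tensorr; congr (_ ∘ _).
rewrite /= tensor1l; apply: (@comp_idR _ (wire b ⊗ wire a ⊗ wires w)%ob).
by rewrite tensor_obA; apply: hom_tensor (Psi_hom _ _) (hom_idm _).
Qed.

Lemma sem_cross v w : tgt (v ++ w) (cross v w) = Some (w ++ v) /\
  sem (v ++ w) (cross v w) = Psi (wires v) (wires w).
Proof.
elim: v => [|a v [IHt IHs]] /=; first by rewrite cats0 Psi_unitl.
have [e1 e2] := sem_shiftl [:: a] IHt.
have [e3 e4] := sem_cross1 a w.
have [e5 e6] := sem_shiftr v e3.
have [e7 e8] := sem_cat e1 e5; split; first by rewrite e7 -catA.
by rewrite e8 e6 e4 e2 IHs wires1 Psi_tensorl.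
Qed.

Lemma flatP e w v : ety sigs e = Some (w, v) ->
  tgt w (flat sigs e) = Some v /\ sem w (flat sigs e) = denote e.
Proof.
elim: e w v => [o|a b|n|f IHf g IHg|f IHf g IHg] w v /=.
- by case=> <- <-; rewrite odenoteE.
- by case=> <- <-; rewrite !odenoteE; exact: sem_cross.
- case=> <- <-; rewrite !cats0 eqxx tensor1l tensor1r; split=> //.
  by rewrite -odenoteE; apply: comp_idR (hom_gen n).
- case ef: (ety _ f) => [[b c]|] //; case eg: (ety _ g) => [[a b']|] //.
  case: eqP => // e [<- <-]; subst b'.
  have [f1 <-] := IHf _ _ ef; have [g1 <-] := IHg _ _ eg.
  exact: sem_cat.
- case ef: (ety _ f) => [[a b]|] //; case eg: (ety _ g) => [[c d]|] // [<- <-].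
  rewrite /ecod /edom ef eg.
  have [f1 <-] := IHf _ _ ef; have [g1 <-] := IHg _ _ eg.
  have [f2 f3] := sem_shiftr d f1; have [g2 g3] := sem_shiftl a g1.
  have [-> ->] := sem_cat g2 f2; split=> //.
  by rewrite f3 g3; apply: tensor_split (hom_sem f1) (hom_sem g1).
Qed.

Lemma hom_denote e w v : ety sigs e = Some (w, v) ->
  hom (wires w) (wires v) (denote e).
Proof. by move=> /flatP[h <-]; exact: hom_sem. Qed.

Definition rule_holds (R : rule) := denote R.1 = denote R.2.

Lemma eqd_rewrite w R ks block pre : rule_holds R ->
  eqd w (block ++ pre) (rewrite_block sigs w R ks block pre ++ pre).
Proof.
case: R => e1 e2; rewrite /rule_holds /rewrite_block /is_rule /= => hR.
case eks: filter => [|k ks'] //; case et1: (ety _ e1) => [[s t]|] //.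
case: eqP => // et2; apply: eqd_cat => // u eu.
have := mem_head k ks'; rewrite -eks mem_filter eu /=.
move=> /andP[/andP[/eqP eq_u /eqP eq_b] _] {eks}.
rewrite /edom et1 in eq_u eq_b *.
move: (take _ _) (drop _ _) eq_u eq_b => l r eq_u eq_b; subst u.
move=> v ev; have [f1 s1] := flatP et1; have [f2 s2] := flatP et2.
have [c1 c2] := eqd_canon _ f1.
have [g1 g2] := sem_shift l r c1; have [h1 h2] := sem_shift l r f2.
(* The block need not be literally the left-hand side in its context; the two have the same meaning
   because their canonical forms are equal. *)
have [b1 b2] := eqd_canon _ ev; have := eqd_canon _ g1.
rewrite -eq_b b1 b2 => -[[->] ->].
by rewrite h1 h2 g2 c2 s1 s2 hR.
Qed.

Lemma eqd_rw_at w R js d : rule_holds R -> eqd w d (rw_at sigs w R js d).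
Proof.
move=> hR; rewrite /rw_at; have := @eqd_gather w js 0 d.
case: gather => [[post block] pre] h.
refine (eqd_trans h (eqd_trans _ (@eqd_canon _ _))).
by apply: eqd_cat; first exact: eqd_rewrite.
Qed.

Lemma eqd_ins_at w R i k d : rule_holds R -> eqd w d (ins_at sigs w R i k d).
Proof.
move=> hR; refine (eqd_trans _ (@eqd_canon _ _)).
rewrite -{1}(cat_take_drop i d); by apply: eqd_cat; first exact: (@eqd_rewrite _ _ _ [::]).
Qed.

Fixpoint rules_hold (rs : seq rule) : Prop :=
  if rs is R :: rs' then rule_holds R /\ rules_hold rs' else True.

Variable rules : seq rule.
Hypothesis rules_valid : rules_hold rules.

Lemma rule_nth n : rule_holds (nth (EId OUnit, EId OUnit) rules n).
Proof.
elim: rules rules_valid n => [|R rs IH] /=; first by move=> _ n; rewrite nth_nil.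
by move=> [hR hrs] [|n] //=; exact: IH.
Qed.

Lemma odenote_owires w : odenote (owires w) = wires w.
Proof. by elim: w => //= n w ->. Qed.

Lemma psi_rule_lP e (c : nat) w v : ety sigs e = Some (w, v) ->
  rule_holds (psi_rule_l sigs e c).
Proof.
move=> he; have h := hom_denote he.
rewrite /rule_holds /= !odenote_owires /edom /ecod he.
exact: Psi_nat h (hom_idm _).
Qed.

Lemma psi_rule_rP e (c : nat) w v : ety sigs e = Some (w, v) ->
  rule_holds (psi_rule_r sigs c e).
Proof.
move=> he; have h := hom_denote he.
rewrite /rule_holds /= !odenote_owires /edom /ecod he.
exact: Psi_nat (hom_idm _) h.
Qed.

Lemma get_ruleP r : rule_holds (get_rule sigs rules r).
Proof.
case: r => [n|e c|c e] /=; first exact: rule_nth.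
- by case he: (ety sigs e) => [[w v]|] //; exact: psi_rule_lP he.
- by case he: (ety sigs e) => [[w v]|] //; exact: psi_rule_rP he.
Qed.

Lemma eqd_step w s d : eqd w d (do_step sigs rules w s d).
Proof.
by case: s => [r js|r js|r i k|r i k]; [apply: eqd_rw_at|apply: eqd_rw_at
  |apply: eqd_ins_at|apply: eqd_ins_at]; have := get_ruleP r.
Qed.

Lemma eqd_run w s d : eqd w d (run sigs rules w s d).
Proof.
rewrite /run; refine (eqd_trans (@eqd_canon _ _) _).
elim: s (canon _ d) => [|x s IH] d' //=.
exact (eqd_trans (@eqd_step _ _ _) (IH _)).
Qed.

Lemma checkP e1 e2 s1 s2 : check sigs rules e1 e2 s1 s2 -> denote e1 = denote e2.
Proof.
rewrite /check; case et1: ety => [[w v]|] // /andP[/eqP et2 /eqP e].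
have [f1 <-] := flatP et1; have [f2 <-] := flatP et2.
have [_ <-] := @eqd_run w s1 _ _ f1; have [_ <-] := @eqd_run w s2 _ _ f2.
by rewrite e.
Qed.

Lemma hom_checkP e (a b : oexpr) : ety sigs e = Some (oflat a, oflat b) ->
  hom (odenote a) (odenote b) (denote e).
Proof. by rewrite !odenoteE; exact: hom_denote. Qed.

End Semantics.

(** * Reification of arrows and equations *)

Ltac lookup t l :=
  lazymatch l with
  | ?x :: ?l' =>
    match goal with
    (* The inner [match goal] makes [constr_eq] run as a test while a term is being built; its
       failure selects the next branch. *)
    | _ => let _ := match goal with _ => constr_eq x t end in constr:(0)
    | _ => let n := lookup t l' in constr:(S n)
    end
  end.

Ltac reify_ob obs t :=
  lazymatch t with
  | unit_ob => constr:(OUnit)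
  | tensor_ob ?a ?b =>
    let a' := reify_ob obs a in let b' := reify_ob obs b in constr:(OTens a' b')
  | _ => let n := lookup t obs in constr:(OVar n)
  end.

Ltac reify_mor obs gens t :=
  lazymatch t with
  | idm ?a => let a' := reify_ob obs a in constr:(EId a')
  | Psi ?a ?b =>
    let a' := reify_ob obs a in let b' := reify_ob obs b in constr:(EPsi a' b')
  | Defs.comp ?f ?g =>
    let f' := reify_mor obs gens f in let g' := reify_mor obs gens g in
    constr:(EComp f' g')
  | tensor ?f ?g =>
    let f' := reify_mor obs gens f in let g' := reify_mor obs gens g in
    constr:(ETens f' g')
  | _ => let n := lookup t gens in constr:(EGen n)
  end.

Ltac reify_rules obs gens hs acc :=
  lazymatch hs with
  | tt => acc
  | (?hs', ?h) =>
    lazymatch type of h with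
    | ?f = ?g =>
      let f' := reify_mor obs gens f in let g' := reify_mor obs gens g in
      reify_rules obs gens hs' constr:((f', g') :: acc)
    end
  end.

Ltac gens_of hs acc :=
  lazymatch hs with
  | tt => acc
  | (?hs', ?h) =>
    lazymatch type of h with hom _ _ ?g => gens_of hs' constr:(g :: acc) end
  end.

Ltac sigs_of obs hs acc :=
  lazymatch hs with
  | tt => acc
  | (?hs', ?h) =>
    lazymatch type of h with
    | hom ?a ?b _ =>
      let a' := reify_ob obs a in let b' := reify_ob obs b in
      sigs_of obs hs' constr:((a', b') :: acc)
    end
  end.

Ltac conj_all hs acc :=
  lazymatch hs with
  | tt => acc
  | (?hs', ?h) => conj_all hs' constr:(conj h acc)
  end.

(* Arguments: the objects, the typings of the generating morphisms and the
   equations between them, the last two as nested pairs starting with [tt]. In the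
   scripts, objects, generators [EGen] and equations are numbered in this order. *)
Tactic Notation "diagram_in" constr(C) constr(obs) constr(homs) constr(rules)
    uconstr(s1) uconstr(s2) :=
  let gens := gens_of homs constr:(@nil (Mor C)) in
  let sigs := sigs_of obs homs constr:(@nil (oexpr * oexpr)) in
  let ht := conj_all homs constr:(I) in
  let rs := reify_rules obs gens rules constr:(@nil rule) in
  let hr := conj_all rules constr:(I) in
  lazymatch goal with
  | |- ?f = ?g =>
    let e1 := reify_mor obs gens f in
    let e2 := reify_mor obs gens g in
    refine (@checkP C obs gens sigs ht rs hr e1 e2 s1 s2 _);
    vm_compute; reflexivity
  end.

Ltac typing_in C obs homs :=
  let gens := gens_of homs constr:(@nil (Mor C)) in
  let sigs := sigs_of obs homs constr:(@nil (oexpr * oexpr)) in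
  let ht := conj_all homs constr:(I) in
  lazymatch goal with
  | |- hom ?a ?b ?f =>
    let a' := reify_ob obs a in
    let b' := reify_ob obs b in
    let e := reify_mor obs gens f in
    refine (@hom_checkP C obs gens sigs ht e a' b' _); vm_compute; reflexivity
  end.

(** * Duality and mirror symmetry *)

Section Opposite.
Variable C : braided_category.

(** This and the following categories are transparent: statements about them have to reduce by
    conversion to statements about [C], up to bracketing and the direction of equations. *)
Definition op_category : category.
Proof.
refine (@Category (Ob C) (Mor C) (@cod C) (@dom C) (@idm C)
  (fun f g => g ∘ f) (@cod_idm C) (@dom_idm C) _ _ (@comp_idr C) (@comp_idl C) _).
- by move=> f g e; apply: cod_comp.
- by move=> f g e; apply: dom_comp.
- by move=> f g h e1 e2; apply/esym/Defs.compA.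
Defined.

Definition op_smc : strict_monoidal_category.
Proof.
refine (@StrictMonoidalCategory op_category unit_ob (@tensor_ob C) (@tensor C)
  (@cod_tensor C) (@dom_tensor C) (@tensor_idm C) _ (@tensor_obA C)
  (@tensor_ob1l C) (@tensor_ob1r C) (@tensorA C) (@tensor1l C) (@tensor1r C)).
by move=> f f' g g' e1 e2; apply: tensor_comp.
Defined.

(** An arrow from a ⊗ b to b ⊗ a in the opposite category is one from b ⊗ a to a ⊗ b in [C], so
    [Psi b a] fits without inverting the braiding; the same choice works for [mirror]. *)
Definition op : braided_category.
Proof.
refine (@BraidedCategory op_smc (fun a b => Psi b a) _ _ _ _ _).
- by move=> a b; have [] := Psi_hom b a.
- by move=> a b; have [g [? ? ? ?]] := Psi_iso b a; exists g; split=> //=; apply/esym.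
- by move=> f g; apply/esym/(Psi_natural g f).
- by move=> a b c; apply: Psi_tensorl.
- by move=> a b c; apply: Psi_tensorr.
Defined.

Definition mirror_smc : strict_monoidal_category.
Proof.
refine (@StrictMonoidalCategory C unit_ob (fun a b => tensor_ob b a)
  (fun f g => tensor g f) _ _ _ _ _ (@tensor_ob1r C) (@tensor_ob1l C) _
  (@tensor1r C) (@tensor1l C)).
- by move=> f g; apply: dom_tensor.
- by move=> f g; apply: cod_tensor.
- by move=> a b; apply: tensor_idm.
- by move=> f f' g g' e1 e2; apply: tensor_comp.
- by move=> a b c; apply/esym/tensor_obA.
- by move=> f g h; apply/esym/tensorA.
Defined.

Definition mirror : braided_category.
Proof.
refine (@BraidedCategory mirror_smc (fun a b => Psi b a) _ _ _ _ _).
- by move=> a b; apply: Psi_hom.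
- by move=> a b; apply: Psi_iso.
- by move=> f g; apply: Psi_natural.
- by move=> a b c; apply: Psi_tensorl.
- by move=> a b c; apply: Psi_tensorr.
Defined.

Definition op_pre (A : prebialgebra C) : prebialgebra op :=
  @Prebialgebra op (carrier A) (Delta A) (eps A) (mul A) (eta A).
Definition mirror_pre (A : prebialgebra C) : prebialgebra mirror :=
  @Prebialgebra mirror (carrier A) (mul A) (eta A) (Delta A) (eps A).

Lemma op_hom a b (f : Mor C) : @hom C a b f -> @hom op b a f.
Proof. by case. Qed.

Lemma op_inverse (f g : Mor C) : @inverse C f g -> @inverse op g f.
Proof.
by case=> e1 e2 e3 e4; split; rewrite /= ?e3 ?e4 ?e1 ?e2.
Qed.

Implicit Types A B : prebialgebra C.

Lemma op_algebra A : is_coalgebra A -> is_algebra (op_pre A).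
Proof. by case=> [[[? ?] [? ?]] ? ? ?]. Qed.

Lemma op_coalgebra A : is_algebra A -> is_coalgebra (op_pre A).
Proof. by case=> [[[? ?] [? ?]] ? ? ?]. Qed.

Lemma op_algebraK A : is_coalgebra (op_pre A) -> is_algebra A.
Proof. by case=> [[[? ?] [? ?]] ? ? ?]. Qed.

Lemma op_coalgebraK A : is_algebra (op_pre A) -> is_coalgebra A.
Proof. by case=> [[[? ?] [? ?]] ? ? ?]. Qed.

Lemma op_algebra_morphismK A B f :
  algebra_morphism (op_pre B) (op_pre A) f -> coalgebra_morphism A B f.
Proof. by case=> [[? ?] ? ?]; split. Qed.

Lemma mirror_algebra A : is_algebra A -> is_algebra (mirror_pre A).
Proof. by case=> [[? ?] ? ? ?]; split. Qed.

Lemma mirror_coalgebra A : is_coalgebra A -> is_coalgebra (mirror_pre A).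
Proof. by case=> [[? ?] ? ? ?]; split. Qed.

Lemma op_algebra_morphism A B f :
  coalgebra_morphism A B f -> algebra_morphism (op_pre B) (op_pre A) f.
Proof. by case=> [[? ?] ? ?]; split=> //. Qed.

Lemma op_coalgebra_morphism A B f :
  algebra_morphism A B f -> coalgebra_morphism (op_pre B) (op_pre A) f.
Proof. by case=> [[? ?] ? ?]; split=> //. Qed.

Lemma mirror_algebra_morphism A B f :
  algebra_morphism A B f -> algebra_morphism (mirror_pre A) (mirror_pre B) f.
Proof. by case=> [[? ?] ? ?]; split. Qed.

Lemma mirror_coalgebra_morphism A B f :
  coalgebra_morphism A B f -> coalgebra_morphism (mirror_pre A) (mirror_pre B) f.
Proof. by case=> [[? ?] ? ?]; split. Qed.

(** Reversing composition also reverses the bracketing of the bialgebra equation, and restoring it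
    takes the typings of the arrows. *)
Lemma bialgebra_equation_assoc A : is_algebra A -> is_coalgebra A ->
  (mul A ⊗ mul A) ∘ ((idm A ⊗ Psi A A ⊗ idm A) ∘ (Delta A ⊗ Delta A)) =
  (mul A ⊗ mul A) ∘ (idm A ⊗ (Psi A A ⊗ idm A)) ∘ (Delta A ⊗ Delta A).
Proof.
move=> [[hm _] _ _ _] [[hd _] _ _ _].
diagram_in C [:: carrier A] (tt, hm, hd) tt [::] [::].
Qed.

Lemma op_bialgebra A : is_bialgebra A <-> is_bialgebra (op_pre A).
Proof.
split=> -[ha hc e he hu]; split.
- exact: op_algebra.
- exact: op_coalgebra.
- by rewrite /= e bialgebra_equation_assoc // tensorA.
- exact: op_algebra_morphism hu.
- exact: op_coalgebra_morphism he.
- exact: op_algebraK.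
- exact: op_coalgebraK.
- rewrite [LHS]e /= bialgebra_equation_assoc ?tensorA //.
  exact: op_algebraK. exact: op_coalgebraK.
- by case: hu => -[? ?] ? ?; split.
- by case: he => -[? ?] ? ?; split.
Qed.

Lemma mirror_bialgebra A : is_bialgebra A <-> is_bialgebra (mirror_pre A).
Proof.
split=> -[ha hc e he hu]; split=> //.
- exact: mirror_algebra.
- exact: mirror_coalgebra.
- by rewrite /= e tensorA.
- by case: ha => -[? ?] ? ? ?; split.
- by case: hc => -[? ?] ? ? ?; split.
- by rewrite [LHS]e /= tensorA.
Qed.

Lemma op_cross_product B1 B2 phi12 phi21 :
  op_pre (cross_product B1 B2 phi12 phi21) =
  cross_product (op_pre B1) (op_pre B2) phi21 phi12.
Proof. by []. Qed.

Lemma mirror_cross_product B1 B2 phi12 phi21 :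
  mirror_pre (cross_product B1 B2 phi12 phi21) =
  cross_product (mirror_pre B2) (mirror_pre B1) phi12 phi21.
Proof. by rewrite /cross_product /mirror_pre /= !tensorA. Qed.

End Opposite.

(** * Symmetries of Hopf data *)

Section HopfDatumSymmetry.
Variable C : braided_category.
Variables (B1 B2 : prebialgebra C) (mu_l nu_l mu_r nu_r : Mor C).
Hypothesis hd : is_hopf_datum B1 B2 mu_l nu_l mu_r nu_r.

Let hm1 : hom (B1 ⊗ B1) B1 (mul B1). Proof. by case: (hd_algebra1 hd) => [[]]. Qed.
Let he1 : hom unit_ob B1 (eta B1). Proof. by case: (hd_algebra1 hd) => [[]]. Qed.
Let hd1 : hom B1 (B1 ⊗ B1) (Delta B1). Proof. by case: (hd_coalgebra1 hd) => [[]]. Qed.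
Let hc1 : hom B1 unit_ob (eps B1). Proof. by case: (hd_coalgebra1 hd) => [[]]. Qed.
Let hm2 : hom (B2 ⊗ B2) B2 (mul B2). Proof. by case: (hd_algebra2 hd) => [[]]. Qed.
Let he2 : hom unit_ob B2 (eta B2). Proof. by case: (hd_algebra2 hd) => [[]]. Qed.
Let hd2 : hom B2 (B2 ⊗ B2) (Delta B2). Proof. by case: (hd_coalgebra2 hd) => [[]]. Qed.
Let hc2 : hom B2 unit_ob (eps B2). Proof. by case: (hd_coalgebra2 hd) => [[]]. Qed.
Let hmul : hom (B2 ⊗ B1) B1 mu_l. Proof. by case: (hd_mu_l hd). Qed.
Let hnul : hom B1 (B2 ⊗ B1) nu_l. Proof. by case: (hd_nu_l hd). Qed.
Let hmur : hom (B2 ⊗ B1) B2 mu_r. Proof. by case: (hd_mu_r hd). Qed.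
Let hnur : hom B2 (B2 ⊗ B1) nu_r. Proof. by case: (hd_nu_r hd). Qed.

(** An axiom read in the opposite or mirror category differs from the wanted one by bracketing,
    interchange and possibly direction; all of this is settled by canonical forms, with empty
    scripts. *)
Local Ltac reassociate H :=
  have := H; rewrite /hd_phi12 /hd_phi21 /=;
  let e := fresh in intro e;
  first [refine (etrans _ (etrans e _)) | refine (etrans _ (etrans (esym e) _))];
  diagram_in C [:: carrier B1; carrier B2]
    (tt, hm1, he1, hd1, hc1, hm2, he2, hd2, hc2, hmul, hnul, hmur, hnur)
    tt [::] [::].

Lemma hom_hd_phi12 : hom (B1 ⊗ B2) (B2 ⊗ B1) (hd_phi12 B1 B2 nu_l nu_r).
Proof.
rewrite /hd_phi12.
typing_in C [:: carrier B1; carrier B2] (tt, hm1, hm2, hnul, hnur).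
Qed.

Lemma hom_hd_phi21 : hom (B2 ⊗ B1) (B1 ⊗ B2) (hd_phi21 B1 B2 mu_l mu_r).
Proof.
rewrite /hd_phi21.
typing_in C [:: carrier B1; carrier B2] (tt, hd1, hd2, hmul, hmur).
Qed.

(** The axioms are self-dual as a whole: module-algebra is exchanged with comodule-coalgebra,
    module-coalgebra with comodule-algebra, and the algebra-coalgebra and module-comodule axioms are
    their own duals. *)
Lemma op_hopf_datum : is_hopf_datum (op_pre B1) (op_pre B2) nu_l mu_l nu_r mu_r.
Proof.
case: hd => a1 c1 ce1 ue1 a2 c2 ce2 ue2 [[? ?] ? ?] [[? ?] ? ?] [[? ?] ? ?]
  [[? ?] ? ?] r1 r2 r3 r4 r5 r6 r7 r8 s1 s2 s3 s4 s5 s6 s7 s8 s9 s10 s11.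
split.
- exact: op_algebra.
- exact: op_coalgebra.
- exact: op_algebra_morphism ue1.
- exact: op_coalgebra_morphism ce1.
- exact: op_algebra.
- exact: op_coalgebra.
- exact: op_algebra_morphism ue2.
- exact: op_coalgebra_morphism ce2.
- by split.
- by split.
- by split.
- by split.
- by rewrite /= -r6.
- by rewrite /= -r5.
- by rewrite /= r7.
- by rewrite /= r8.
- by rewrite /= -r2.
- by rewrite /= r1.
- by rewrite /= r3.
- by rewrite /= r4.
- reassociate s1.
- reassociate s2.
- reassociate s3.
- reassociate s6.
- reassociate s7.
- reassociate s4.
- reassociate s5.
- reassociate s10.
- reassociate s11.
- reassociate s8.
- reassociate s9.
Qed.

Lemma mirror_hopf_datum : is_hopf_datum (mirror_pre B2) (mirror_pre B1) mu_r nu_r mu_l nu_l.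
Proof.
case: hd => a1 c1 ce1 ue1 a2 c2 ce2 ue2 [h1 ? ?] [h2 ? ?] [h3 ? ?]
  [h4 ? ?] r1 r2 r3 r4 r5 r6 r7 r8 s1 s2 s3 s4 s5 s6 s7 s8 s9 s10 s11.
split.
- exact: mirror_algebra.
- exact: mirror_coalgebra.
- exact: mirror_algebra_morphism ce2.
- exact: mirror_coalgebra_morphism ue2.
- exact: mirror_algebra.
- exact: mirror_coalgebra.
- exact: mirror_algebra_morphism ce1.
- exact: mirror_coalgebra_morphism ue1.
- by split.
- by split.
- by split.
- by split.
- by rewrite /= r5.
- by rewrite /= r6.
- by rewrite /= r4.
- by rewrite /= r3.
- by rewrite /= r1.
- by rewrite /= r2.
- by rewrite /= r8.
- by rewrite /= r7.
- reassociate s2.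
- reassociate s1.
- reassociate s3.
- reassociate s5.
- reassociate s4.
- reassociate s7.
- reassociate s6.
- reassociate s9.
- reassociate s8.
- reassociate s11.
- reassociate s10.
Qed.

Lemma op_hd_phi12 : hd_phi21 B1 B2 mu_l mu_r =
  hd_phi12 (op_pre B1) (op_pre B2) mu_l mu_r.
Proof. reassociate (erefl (hd_phi21 B1 B2 mu_l mu_r)). Qed.

Lemma op_hd_phi21 : hd_phi12 B1 B2 nu_l nu_r =
  hd_phi21 (op_pre B1) (op_pre B2) nu_l nu_r.
Proof. reassociate (erefl (hd_phi12 B1 B2 nu_l nu_r)). Qed.

End HopfDatumSymmetry.

Lemma mirror_hd_phi12 (C : braided_category) (B1 B2 : prebialgebra C) nu_l nu_r :
  hd_phi12 B1 B2 nu_l nu_r = hd_phi12 (mirror_pre B2) (mirror_pre B1) nu_r nu_l.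
Proof. by rewrite /hd_phi12 /= tensorA. Qed.

Lemma mirror_hd_phi21 (C : braided_category) (B1 B2 : prebialgebra C) mu_l mu_r :
  hd_phi21 B1 B2 mu_l mu_r = hd_phi21 (mirror_pre B2) (mirror_pre B1) mu_r mu_l.
Proof. by rewrite /hd_phi21 /= tensorA. Qed.

(** * Composites and inverses of algebra morphisms *)

Lemma algebra_morphism_comp (C : braided_category) (A B D : prebialgebra C) f g :
  is_algebra A -> is_algebra B -> is_algebra D ->
  algebra_morphism B D f -> algebra_morphism A B g -> algebra_morphism A D (f ∘ g).
Proof.
move=> [[mA eA] _ _ _] [[mB eB] _ _ _] [[mD eD] _ _ _] [hf fm fe] [hg gm ge].
split; first exact: hom_comp hf hg.
- diagram_in C [:: carrier A; carrier B; carrier D] (tt, mA, mB, mD, eA, eB,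
      eD, hf, hg) (tt, fm, gm)
    [:: Rw 1 [:: 1; 2]]
    [:: RwR 0 [:: 0; 1; 3]].
- diagram_in C [:: carrier A; carrier B; carrier D] (tt, mA, mB, mD, eA, eB,
      eD, hf, hg) (tt, fe, ge)
    [:: Rw 1 [:: 1; 2]]
    [:: RwR 0 [:: 0]].
Qed.

Lemma algebra_morphism_inverse (C : braided_category) (A B : prebialgebra C) f g :
  is_algebra A -> is_algebra B ->
  algebra_morphism A B f -> inverse f g -> algebra_morphism B A g.
Proof.
move=> [[hmA heA] _ _ _] [[hmB heB] _ _ _] [hf fm fe] [e1 e2 fg gf].
case: (hf) => df cf; rewrite cf in e2 fg; rewrite df in e1 gf.
have hg : hom B A g by split; apply/esym.
split=> //.
- diagram_in C [:: carrier A; carrier B] (tt, hmA, hmB, heA, heB, hf, hg)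
      (tt, fm, fg, gf)
    [:: InsR 1 2 0; InsR 1 2 1]
    [:: InsR 2 0 0; Rw 0 [:: 1; 2]].
- diagram_in C [:: carrier A; carrier B] (tt, hmA, hmB, heA, heB, hf, hg)
      (tt, fe, gf)
    [:: RwR 0 [:: 1]; Rw 1 [:: 0; 1]]
    [::].
Qed.

(** * Inclusions of the factors in a cross product *)

Section CrossProductFactors.
Variable C : braided_category.
Variables (B1 B2 : prebialgebra C) (phi12 phi21 : Mor C).
Hypothesis bat : is_BAT B1 B2 phi12 phi21.

Local Notation id1 := (idm B1).
Local Notation id2 := (idm B2).
Local Notation m1 := (mul B1).
Local Notation m2 := (mul B2).
Local Notation eta1 := (eta B1).
Local Notation eta2 := (eta B2).
Local Notation Delta1 := (Delta B1).
Local Notation Delta2 := (Delta B2).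
Local Notation eps1 := (eps B1).
Local Notation eps2 := (eps B2).
Local Notation B := (cross_product B1 B2 phi12 phi21).
Local Notation idB := (idm (B1 ⊗ B2)).
Local Notation mB := ((m1 ⊗ m2) ∘ (id1 ⊗ phi21 ⊗ id2)).

Let hm1 : hom (B1 ⊗ B1) B1 m1. Proof. by case: (BAT_algebra1 bat) => [[]]. Qed.
Let heta1 : hom unit_ob B1 eta1. Proof. by case: (BAT_algebra1 bat) => [[]]. Qed.
Let hDelta1 : hom B1 (B1 ⊗ B1) Delta1.
Proof. by case: (BAT_coalgebra1 bat) => [[]]. Qed.
Let heps1 : hom B1 unit_ob eps1. Proof. by case: (BAT_coalgebra1 bat) => [[]]. Qed.
Let hm2 : hom (B2 ⊗ B2) B2 m2. Proof. by case: (BAT_algebra2 bat) => [[]]. Qed.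
Let heta2 : hom unit_ob B2 eta2. Proof. by case: (BAT_algebra2 bat) => [[]]. Qed.
Let hDelta2 : hom B2 (B2 ⊗ B2) Delta2.
Proof. by case: (BAT_coalgebra2 bat) => [[]]. Qed.
Let heps2 : hom B2 unit_ob eps2. Proof. by case: (BAT_coalgebra2 bat) => [[]]. Qed.
Let hphi12 : hom (B1 ⊗ B2) (B2 ⊗ B1) phi12. Proof. exact: BAT_phi12 bat. Qed.
Let hphi21 : hom (B2 ⊗ B1) (B1 ⊗ B2) phi21. Proof. exact: BAT_phi21 bat. Qed.

Local Tactic Notation "diagram" constr(rules) uconstr(s1) uconstr(s2) :=
  diagram_in C [:: carrier B1; carrier B2]
    (tt, hm1, heta1, hDelta1, heps1, hm2, heta2, hDelta2, heps2, hphi21, hphi12)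
    rules s1 s2.
Local Ltac typing :=
  typing_in C [:: carrier B1; carrier B2]
    (tt, hm1, heta1, hDelta1, heps1, hm2, heta2, hDelta2, heps2, hphi21, hphi12).

Let unitl1 : m1 ∘ (eta1 ⊗ id1) = id1. Proof. by case: (BAT_algebra1 bat). Qed.
Let unitr1 : m1 ∘ (id1 ⊗ eta1) = id1. Proof. by case: (BAT_algebra1 bat). Qed.
Let unitl2 : m2 ∘ (eta2 ⊗ id2) = id2. Proof. by case: (BAT_algebra2 bat). Qed.
Let unitr2 : m2 ∘ (id2 ⊗ eta2) = id2. Proof. by case: (BAT_algebra2 bat). Qed.
Let eps_eta1 : eps1 ∘ eta1 = idm unit_ob. Proof. exact: BAT_eps_eta1 bat. Qed.
Let eps_eta2 : eps2 ∘ eta2 = idm unit_ob. Proof. exact: BAT_eps_eta2 bat. Qed.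
Let unitlB : mB ∘ (eta1 ⊗ eta2 ⊗ idB) = idB.
Proof. by case: (BAT_bialgebra bat) => -[]. Qed.
Let unitrB : mB ∘ (idB ⊗ (eta1 ⊗ eta2)) = idB.
Proof. by case: (BAT_bialgebra bat) => -[]. Qed.

(** Multiply id1 ⊗ eta2 on the left by the unit of the cross product: the units of the two factors
    then cancel everything but the twist. The next identity uses multiplication by the unit on the
    right. *)
Let phi21_eta2 : phi21 ∘ (eta2 ⊗ id1) = id1 ⊗ eta2.
Proof.
diagram (tt, unitlB, unitl1, unitr2)
  [::]
  [:: InsR 0 0 0; Rw 1 [:: 2; 5]; Rw 2 [:: 0; 1]].
Qed.
Let phi21_eta1 : phi21 ∘ (id2 ⊗ eta1) = eta1 ⊗ id2.
Proof.
diagram (tt, unitrB, unitl1, unitr2)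
  [::]
  [:: InsR 0 0 0; Rw 1 [:: 2; 5]; Rw 2 [:: 0; 1]].
Qed.

Lemma cross_product_inclusion1 : algebra_morphism B1 B (id1 ⊗ eta2).
Proof.
split=> /=; first by typing.
- diagram (tt, phi21_eta2, unitr2) [::] [:: Rw 1 [:: 0; 1]; Rw 0 [:: 1; 2]].
- diagram tt [::] [::].
Qed.

Lemma cross_product_inclusion2 : algebra_morphism B2 B (eta1 ⊗ id2).
Proof.
split=> /=; first by typing.
- diagram (tt, phi21_eta1, unitl1) [::] [:: Rw 1 [:: 1; 4]; Rw 0 [:: 1; 2]].
- diagram tt [::] [::].
Qed.

Lemma cross_product_mul_inclusions :
  mul B ∘ ((id1 ⊗ eta2) ⊗ (eta1 ⊗ id2)) = idm B.
Proof.
rewrite /=.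
diagram (tt, phi21_eta2, unitr1, unitl2)
  [:: Rw 0 [:: 2; 4]; Rw 1 [:: 2; 3]; Rw 2 [:: 0; 1]]
  [::].
Qed.

Lemma cross_product_retract1 : (id1 ⊗ eps2) ∘ (id1 ⊗ eta2) = id1.
Proof.
diagram (tt, eps_eta2) [:: Rw 0 [:: 0; 1]] [::].
Qed.

Lemma cross_product_retract2 : (eps1 ⊗ id2) ∘ (eta1 ⊗ id2) = id2.
Proof.
diagram (tt, eps_eta1) [:: Rw 0 [:: 0; 1]] [::].
Qed.

End CrossProductFactors.

(** * Algebra and coalgebra structure on the image of a compatible idempotent *)

Definition compatible_idempotent (C : braided_category) (A : prebialgebra C)
    (Pi : Mor C) : Prop :=
  [/\ mul A ∘ (Pi ⊗ Pi) = Pi ∘ mul A ∘ (Pi ⊗ Pi),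
      Pi ∘ eta A = eta A,
      (Pi ⊗ Pi) ∘ Delta A = (Pi ⊗ Pi) ∘ Delta A ∘ Pi
    & eps A ∘ Pi = eps A].

Section SplitIdempotent.
Variable C : braided_category.
Variables (A : prebialgebra C) (N : Ob C) (p i : Mor C).
Hypothesis algA : is_algebra A.
Hypothesis coalgA : is_coalgebra A.
Hypothesis hp : hom A N p.
Hypothesis hi : hom N A i.
Hypothesis pi : p ∘ i = idm N.
Hypothesis comp_Pi : compatible_idempotent A (i ∘ p).

Local Notation mA := (mul A).
Local Notation etaA := (eta A).
Local Notation DeltaA := (Delta A).
Local Notation epsA := (eps A).
Local Notation idA := (idm A).
Local Notation mN := (p ∘ mA ∘ (i ⊗ i)).
Local Notation etaN := (p ∘ etaA).
Local Notation DeltaN := ((p ⊗ p) ∘ DeltaA ∘ i).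
Local Notation epsN := (epsA ∘ i).

Definition split_prebialgebra : prebialgebra C := Prebialgebra N mN etaN DeltaN epsN.

Let hmA : hom (A ⊗ A) A mA. Proof. by case: algA => [[]]. Qed.
Let hetaA : hom unit_ob A etaA. Proof. by case: algA => [[]]. Qed.
Let hDeltaA : hom A (A ⊗ A) DeltaA. Proof. by case: coalgA => [[]]. Qed.
Let hepsA : hom A unit_ob epsA. Proof. by case: coalgA => [[]]. Qed.

Local Tactic Notation "diagram" constr(rules) uconstr(s1) uconstr(s2) :=
  diagram_in C [:: carrier A; N] (tt, hmA, hetaA, hDeltaA, hepsA, hi, hp)
    rules s1 s2.
Local Ltac typing :=
  typing_in C [:: carrier A; N] (tt, hmA, hetaA, hDeltaA, hepsA, hi, hp).

Let assoc : mA ∘ (mA ⊗ idA) = mA ∘ (idA ⊗ mA). Proof. by case: algA. Qed.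
Let unitl : mA ∘ (etaA ⊗ idA) = idA. Proof. by case: algA. Qed.
Let unitr : mA ∘ (idA ⊗ etaA) = idA. Proof. by case: algA. Qed.
Let Pi_mul : mA ∘ ((i ∘ p) ⊗ (i ∘ p)) = (i ∘ p) ∘ mA ∘ ((i ∘ p) ⊗ (i ∘ p)).
Proof. by case: comp_Pi. Qed.
Let Pi_eta : (i ∘ p) ∘ etaA = etaA. Proof. by case: comp_Pi. Qed.

Let coassoc : (DeltaA ⊗ idA) ∘ DeltaA = (idA ⊗ DeltaA) ∘ DeltaA.
Proof. by case: coalgA. Qed.
Let counitl : (epsA ⊗ idA) ∘ DeltaA = idA. Proof. by case: coalgA. Qed.
Let counitr : (idA ⊗ epsA) ∘ DeltaA = idA. Proof. by case: coalgA. Qed.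
Let Pi_Delta : ((i ∘ p) ⊗ (i ∘ p)) ∘ DeltaA =
  ((i ∘ p) ⊗ (i ∘ p)) ∘ DeltaA ∘ (i ∘ p).
Proof. by case: comp_Pi. Qed.
Let Pi_eps : epsA ∘ (i ∘ p) = epsA. Proof. by case: comp_Pi. Qed.

(** Once i is replaced by i p i on both arguments, this is the closure of the image of i p under the
    product; [p_Delta] is the dual argument. *)
Let i_mul : i ∘ mN = mA ∘ (i ⊗ i).
Proof.
diagram (tt, pi, Pi_mul)
  [:: InsR 0 4 1; InsR 0 7 0]
  [:: InsR 0 2 1; InsR 0 5 0; Rw 1 [:: 0; 1; 2; 4; 5]].
Qed.

Let p_Delta : DeltaN ∘ p = (p ⊗ p) ∘ DeltaA.
Proof.
diagram (tt, pi, Pi_Delta)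
  [:: InsR 0 0 0; InsR 0 0 1]
  [:: InsR 0 0 0; InsR 0 0 1; Rw 1 [:: 1; 2; 4; 5; 6]].
Qed.

Lemma split_algebra : is_algebra split_prebialgebra.
Proof.
split=> /=; first by split; typing.
- diagram (tt, assoc, i_mul)
    [:: Rw 1 [:: 3; 4; 5; 6; 7]; Rw 0 [:: 1; 3]]
    [:: Rw 1 [:: 2; 3; 4; 5; 6]].
- diagram (tt, Pi_eta, unitl, pi)
    [:: Rw 0 [:: 3; 4; 5]; Rw 1 [:: 1; 3]; Rw 2 [:: 0; 1]]
    [::].
- diagram (tt, Pi_eta, unitr, pi)
    [:: Rw 0 [:: 2; 3; 4]; Rw 1 [:: 1; 2]; Rw 2 [:: 0; 1]]
    [::].
Qed.

Lemma split_inclusion : algebra_morphism split_prebialgebra A i.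
Proof.
split=> //=.
diagram (tt, Pi_eta) [:: Rw 0 [:: 0; 1; 2]] [::].
Qed.

Lemma split_coalgebra : is_coalgebra split_prebialgebra.
Proof.
split=> /=; first by split; typing.
- diagram (tt, coassoc, p_Delta)
    [:: Rw 1 [:: 1; 2; 3; 4; 5]; Rw 0 [:: 3; 4]]
    [:: Rw 1 [:: 0; 1; 2; 3; 4]].
- diagram (tt, Pi_eps, counitl, pi)
    [:: Rw 0 [:: 1; 2; 3]; Rw 1 [:: 1; 2]; Rw 2 [:: 0; 1]]
    [::].
- diagram (tt, Pi_eps, counitr, pi)
    [:: Rw 0 [:: 0; 1; 2]; Rw 1 [:: 0; 2]; Rw 2 [:: 0; 1]]
    [::].
Qed.

Lemma split_projection : coalgebra_morphism A split_prebialgebra p.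
Proof.
split=> //=.
diagram (tt, Pi_eps) [:: Rw 0 [:: 0; 1; 2]] [::].
Qed.

End SplitIdempotent.

(** A product of a1 a2 by b1 b2 is a1 (a2 b1) b2. Associativity of [mT] regroups its image so that
    D1 and D2 only meet in the products 11, 22, 21 and 12 of the hypotheses. It is applied with T =
    B ⊗ B. *)
Lemma multiplicative_on_factors (C : braided_category) (B1 B2 T : Ob C)
    (m1 m2 phi D D1 D2 mT : Mor C) :
  hom (B1 ⊗ B1) B1 m1 -> hom (B2 ⊗ B2) B2 m2 -> hom (B2 ⊗ B1) (B1 ⊗ B2) phi ->
  hom (B1 ⊗ B2) T D -> hom B1 T D1 -> hom B2 T D2 -> hom (T ⊗ T) T mT ->
  mT ∘ (mT ⊗ idm T) = mT ∘ (idm T ⊗ mT) ->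
  D = mT ∘ (D1 ⊗ D2) -> D1 ∘ m1 = mT ∘ (D1 ⊗ D1) ->
  D2 ∘ m2 = mT ∘ (D2 ⊗ D2) -> D ∘ phi = mT ∘ (D2 ⊗ D1) ->
  D ∘ ((m1 ⊗ m2) ∘ (idm B1 ⊗ phi ⊗ idm B2)) = mT ∘ (D ⊗ D).
Proof.
move=> hm1 hm2 hphi hD hD1 hD2 hmT assocT r12 r11 r22 r21.
diagram_in C [:: B1; B2; T] (tt, hm1, hm2, hphi, hD, hD1, hD2, hmT) (tt,
    assocT, r12, r11, r22, r21)
  [:: Rw 1 [:: 0]; Rw 3 [:: 1; 2]; RwR 0 [:: 0; 1]; Rw 2 [:: 4; 5];
    Rw 0 [:: 2; 4]]
  [:: Rw 1 [:: 1]; RwR 0 [:: 0; 1]; Rw 1 [:: 4]; Rw 0 [:: 2; 4];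
    RwR 4 [:: 3; 4; 5]; Rw 1 [:: 3]].
Qed.

Lemma tensor_square_assoc (C : braided_category) (A : Ob C) (m : Mor C) :
  let mAA := (m ⊗ m) ∘ (idm A ⊗ Psi A A ⊗ idm A) in
  hom (A ⊗ A) A m -> m ∘ (m ⊗ idm A) = m ∘ (idm A ⊗ m) ->
  mAA ∘ (mAA ⊗ idm (A ⊗ A)) = mAA ∘ (idm (A ⊗ A) ⊗ mAA).
Proof.
move=> /= hm assoc; pose gm := EGen 0.
diagram_in C [:: A] (tt, hm) (tt, assoc)
  [:: Rw (NatL gm 0) [:: 2; 3]; Rw 0 [:: 0; 1]]
  [:: Rw (NatR 0 gm) [:: 3; 4]; RwR 0 [:: 2; 3]].
Qed.

(** * Hopf data with a trivial right action *)

Section TrivialRightAction.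
Variable C : braided_category.
Variables (B1 B2 : prebialgebra C) (mu_l nu_l nu_r : Mor C).

Local Notation id1 := (idm B1).
Local Notation id2 := (idm B2).
Local Notation m1 := (mul B1).
Local Notation m2 := (mul B2).
Local Notation eta1 := (eta B1).
Local Notation eta2 := (eta B2).
Local Notation Delta1 := (Delta B1).
Local Notation Delta2 := (Delta B2).
Local Notation eps1 := (eps B1).
Local Notation eps2 := (eps B2).
Local Notation phi12 := (hd_phi12 B1 B2 nu_l nu_r).
Local Notation phi21 := (hd_phi21 B1 B2 mu_l (id2 ⊗ eps1)).
Local Notation phi12_def := ((m2 ⊗ m1) ∘ (id2 ⊗ Psi B1 B2 ⊗ id1) ∘ (nu_l ⊗ nu_r)).
Local Notation phi21_def := ((mu_l ⊗ id2) ∘ (id2 ⊗ Psi B2 B1) ∘ (Delta2 ⊗ id1)).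
Local Notation idB := (idm (B1 ⊗ B2)).
Local Notation mB := ((m1 ⊗ m2) ∘ (id1 ⊗ phi21 ⊗ id2)).
Local Notation DeltaB := ((id1 ⊗ phi12 ⊗ id2) ∘ (Delta1 ⊗ Delta2)).
(** [mBB] is the product of the braided tensor square of B; [D1] and [D2] are, after simplification,
    the restrictions of [DeltaB] along id1 ⊗ eta2 and eta1 ⊗ id2. *)
Local Notation mBB :=
  ((mB ⊗ mB) ∘ (idB ⊗ Psi (B1 ⊗ B2) (B1 ⊗ B2) ⊗ idB)).
Local Notation D1 := (((id1 ⊗ nu_l) ∘ Delta1) ⊗ eta2).
Local Notation D2 := (eta1 ⊗ ((nu_r ⊗ id2) ∘ Delta2)).

Hypothesis hd : is_hopf_datum B1 B2 mu_l nu_l (id2 ⊗ eps1) nu_r.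

Let hm1 : hom (B1 ⊗ B1) B1 m1. Proof. by case: (hd_algebra1 hd) => [[]]. Qed.
Let heta1 : hom unit_ob B1 eta1. Proof. by case: (hd_algebra1 hd) => [[]]. Qed.
Let hDelta1 : hom B1 (B1 ⊗ B1) Delta1.
Proof. by case: (hd_coalgebra1 hd) => [[]]. Qed.
Let heps1 : hom B1 unit_ob eps1. Proof. by case: (hd_coalgebra1 hd) => [[]]. Qed.
Let hm2 : hom (B2 ⊗ B2) B2 m2. Proof. by case: (hd_algebra2 hd) => [[]]. Qed.
Let heta2 : hom unit_ob B2 eta2. Proof. by case: (hd_algebra2 hd) => [[]]. Qed.
Let hDelta2 : hom B2 (B2 ⊗ B2) Delta2.
Proof. by case: (hd_coalgebra2 hd) => [[]]. Qed.
Let heps2 : hom B2 unit_ob eps2. Proof. by case: (hd_coalgebra2 hd) => [[]]. Qed.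
Let hmu_l : hom (B2 ⊗ B1) B1 mu_l. Proof. by case: (hd_mu_l hd). Qed.
Let hnu_l : hom B1 (B2 ⊗ B1) nu_l. Proof. by case: (hd_nu_l hd). Qed.
Let hnu_r : hom B2 (B2 ⊗ B1) nu_r. Proof. by case: (hd_nu_r hd). Qed.
Let hphi21 : hom (B2 ⊗ B1) (B1 ⊗ B2) phi21.
Proof.
rewrite /hd_phi21.
typing_in C [:: carrier B1; carrier B2] (tt, hDelta1, heps1, hDelta2, hmu_l).
Qed.
Let hphi12 : hom (B1 ⊗ B2) (B2 ⊗ B1) phi12.
Proof.
rewrite /hd_phi12.
typing_in C [:: carrier B1; carrier B2] (tt, hm1, hm2, hnu_l, hnu_r).
Qed.

Local Tactic Notation "diagram" constr(rules) uconstr(s1) uconstr(s2) :=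
  diagram_in C [:: carrier B1; carrier B2]
    (tt, hm1, heta1, hDelta1, heps1, hm2, heta2, hDelta2, heps2,
     hphi21, hphi12, hmu_l, hnu_l, hnu_r) rules s1 s2.
Local Ltac typing :=
  typing_in C [:: carrier B1; carrier B2]
    (tt, hm1, heta1, hDelta1, heps1, hm2, heta2, hDelta2, heps2,
     hphi21, hphi12, hmu_l, hnu_l, hnu_r).

Local Notation gm1 := (EGen 0).
Local Notation geta1 := (EGen 1).
Local Notation gDelta1 := (EGen 2).
Local Notation geps1 := (EGen 3).
Local Notation gm2 := (EGen 4).
Local Notation geta2 := (EGen 5).
Local Notation gDelta2 := (EGen 6).
Local Notation geps2 := (EGen 7).
Local Notation gmu_l := (EGen 10).
Local Notation gnu_l := (EGen 11).
Local Notation gnu_r := (EGen 12).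

Let assoc1 : m1 ∘ (m1 ⊗ id1) = m1 ∘ (id1 ⊗ m1).
Proof. by case: (hd_algebra1 hd). Qed.
Let unitl1 : m1 ∘ (eta1 ⊗ id1) = id1. Proof. by case: (hd_algebra1 hd). Qed.
Let unitr1 : m1 ∘ (id1 ⊗ eta1) = id1. Proof. by case: (hd_algebra1 hd). Qed.
Let assoc2 : m2 ∘ (m2 ⊗ id2) = m2 ∘ (id2 ⊗ m2).
Proof. by case: (hd_algebra2 hd). Qed.
Let unitl2 : m2 ∘ (eta2 ⊗ id2) = id2. Proof. by case: (hd_algebra2 hd). Qed.
Let unitr2 : m2 ∘ (id2 ⊗ eta2) = id2. Proof. by case: (hd_algebra2 hd). Qed.
Let coassoc1 : (Delta1 ⊗ id1) ∘ Delta1 = (id1 ⊗ Delta1) ∘ Delta1.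
Proof. by case: (hd_coalgebra1 hd). Qed.
Let counitl1 : (eps1 ⊗ id1) ∘ Delta1 = id1.
Proof. by case: (hd_coalgebra1 hd). Qed.
Let counitr1 : (id1 ⊗ eps1) ∘ Delta1 = id1.
Proof. by case: (hd_coalgebra1 hd). Qed.
Let coassoc2 : (Delta2 ⊗ id2) ∘ Delta2 = (id2 ⊗ Delta2) ∘ Delta2.
Proof. by case: (hd_coalgebra2 hd). Qed.
Let counitl2 : (eps2 ⊗ id2) ∘ Delta2 = id2.
Proof. by case: (hd_coalgebra2 hd). Qed.
Let counitr2 : (id2 ⊗ eps2) ∘ Delta2 = id2.
Proof. by case: (hd_coalgebra2 hd). Qed.
Let eps_mul1 : eps1 ∘ m1 = eps1 ⊗ eps1.
Proof. case: (hd_eps1 hd) => _ -> _ /=; diagram tt [::] [::]. Qed.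
Let eps_mul2 : eps2 ∘ m2 = eps2 ⊗ eps2.
Proof. case: (hd_eps2 hd) => _ -> _ /=; diagram tt [::] [::]. Qed.
Let eps_eta1 : eps1 ∘ eta1 = idm unit_ob. Proof. by case: (hd_eps1 hd). Qed.
Let eps_eta2 : eps2 ∘ eta2 = idm unit_ob. Proof. by case: (hd_eps2 hd). Qed.
Let Delta_eta1 : Delta1 ∘ eta1 = eta1 ⊗ eta1.
Proof. case: (hd_eta1 hd) => _ -> _ /=; diagram tt [::] [::]. Qed.
Let Delta_eta2 : Delta2 ∘ eta2 = eta2 ⊗ eta2.
Proof. case: (hd_eta2 hd) => _ -> _ /=; diagram tt [::] [::]. Qed.
Let mu_l_mul : mu_l ∘ (m2 ⊗ id1) = mu_l ∘ (id2 ⊗ mu_l).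
Proof. by case: (hd_mu_l hd). Qed.
Let mu_l_unit : mu_l ∘ (eta2 ⊗ id1) = id1. Proof. by case: (hd_mu_l hd). Qed.
Let nu_l_Delta : (Delta2 ⊗ id1) ∘ nu_l = (id2 ⊗ nu_l) ∘ nu_l.
Proof. by case: (hd_nu_l hd). Qed.
Let nu_l_counit : (eps2 ⊗ id1) ∘ nu_l = id1. Proof. by case: (hd_nu_l hd). Qed.
Let nu_r_Delta : (id2 ⊗ Delta1) ∘ nu_r = (nu_r ⊗ id1) ∘ nu_r.
Proof. by case: (hd_nu_r hd). Qed.
Let nu_r_counit : (id2 ⊗ eps1) ∘ nu_r = id2. Proof. by case: (hd_nu_r hd). Qed.
Let mu_l_eta1 : mu_l ∘ (id2 ⊗ eta1) = eta1 ∘ eps2. Proof. exact: hd_mu_l_eta hd. Qed.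
Let eps1_mu_l : eps1 ∘ mu_l = eps2 ⊗ eps1.
Proof. by rewrite (hd_eps_mu_l hd). Qed.
Let nu_l_eps1 : (id2 ⊗ eps1) ∘ nu_l = eta2 ∘ eps1.
Proof. by rewrite (hd_nu_l_eps hd). Qed.
Let nu_r_eps2 : (eps2 ⊗ id1) ∘ nu_r = eta1 ∘ eps2.
Proof. by rewrite (hd_nu_r_eps hd). Qed.
Let nu_r_eta2 : nu_r ∘ eta2 = eta2 ⊗ eta1. Proof. exact: hd_nu_r_eta hd. Qed.
Let nu_l_eta1 : nu_l ∘ eta1 = eta2 ⊗ eta1. Proof. by rewrite (hd_nu_l_eta hd). Qed.

(** In diagrams the twists are generators, opaque to reification; these two equations open them
    where needed. In [phi21] the trivial action leaves a counit on [Delta1], which disappears. *)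
Let phi12E : phi12 = phi12_def.
Proof. by []. Qed.
Let phi21E : phi21 = phi21_def.
Proof.
rewrite /hd_phi21.
diagram (tt, counitr1) [:: Rw 0 [:: 0; 3]] [::].
Qed.

(** The trivial action only sees the counit of the B1-leg of nu_r, so B2 becomes an ordinary braided
    bialgebra, whereas B1 keeps its twisted compatibility. *)
Let Delta_mul2 : Delta2 ∘ m2 =
  (m2 ⊗ m2) ∘ (id2 ⊗ Psi B2 B2 ⊗ id2) ∘ (Delta2 ⊗ Delta2).
Proof.
rewrite (hd_algebra_coalgebra2 hd).
diagram (tt, nu_r_counit) [:: Rw 0 [:: 1; 4]] [::].
Qed.
Let algebra_coalgebra1 : Delta1 ∘ m1 =
  (m1 ⊗ m1) ∘ (id1 ⊗ mu_l ⊗ id1 ⊗ id1) ∘ (id1 ⊗ id2 ⊗ Psi B1 B1 ⊗ id1)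
    ∘ (id1 ⊗ nu_l ⊗ id1 ⊗ id1) ∘ (Delta1 ⊗ Delta1).
Proof. exact: hd_algebra_coalgebra1 hd. Qed.
Let module_comodule : phi12_def ∘ phi21_def =
  (m2 ⊗ m1) ∘ (id2 ⊗ Psi B1 B2 ⊗ mu_l) ∘ (nu_r ⊗ Psi B2 B2 ⊗ id1)
    ∘ (Delta2 ⊗ nu_l).
Proof.
rewrite -phi21E -phi12E (hd_module_comodule hd).
diagram (tt, counitl1)
  [:: RwR (NatR 0 geps1) [:: 6; 7]; RwR (NatR 1 geps1) [:: 6; 7];
    Rw 0 [:: 6; 7]]
  [::].
Qed.
Let module_algebra_l : mu_l ∘ (id2 ⊗ m1) = m1 ∘ (id1 ⊗ mu_l) ∘ (phi21_def ⊗ id1).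
Proof. rewrite -phi21E; exact: hd_module_algebra_l hd. Qed.
Let comodule_coalgebra_r : (Delta2 ⊗ id1) ∘ nu_r = (id2 ⊗ phi12_def) ∘ (nu_r ⊗ id2) ∘ Delta2.
Proof. exact: hd_comodule_coalgebra_r hd. Qed.
Let comodule_coalgebra_l : (id2 ⊗ Delta1) ∘ nu_l = (phi12_def ⊗ id1) ∘ (id1 ⊗ nu_l) ∘ Delta1.
Proof. exact: hd_comodule_coalgebra_l hd. Qed.
Let module_coalgebra_l : Delta1 ∘ mu_l =
  (mu_l ⊗ m1) ∘ (id2 ⊗ Psi B1 B1 ⊗ mu_l) ∘ (nu_r ⊗ Psi B2 B1 ⊗ id1)
    ∘ (Delta2 ⊗ Delta1).
Proof. exact: hd_module_coalgebra_l hd. Qed.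
Let comodule_algebra_r : nu_r ∘ m2 =
  (m2 ⊗ m1) ∘ (id2 ⊗ Psi B1 B2 ⊗ mu_l) ∘ (nu_r ⊗ Psi B2 B2 ⊗ id1)
    ∘ (Delta2 ⊗ nu_r).
Proof. exact: hd_comodule_algebra_r hd. Qed.
Let comodule_algebra_l : nu_l ∘ m1 =
  (m2 ⊗ m1) ∘ (id2 ⊗ Psi B1 B2 ⊗ id1) ∘ (nu_l ⊗ nu_l).
Proof.
rewrite (hd_comodule_algebra_l hd).
diagram (tt, counitl1) [:: RwR (NatR 0 geps1) [:: 4; 5]; Rw 0 [:: 4; 5]] [::].
Qed.

(** The twist sends a ⊗ x to a_(1).x ⊗ a_(2), up to braiding. It is compatible with m2 because mu_l
    is an action and Delta2 is multiplicative; with m1, below, by the module-algebra axiom and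
    coassociativity. *)
Let phi21_mul2 : phi21 ∘ (m2 ⊗ id1) = (id1 ⊗ m2) ∘ (phi21 ⊗ id2) ∘ (id2 ⊗ phi21).
Proof.
rewrite !phi21E.
diagram (tt, mu_l_mul, Delta_mul2)
  [:: Rw 1 [:: 2; 3]]
  [:: Rw (NatR 1 gmu_l) [:: 2; 3]; RwR 0 [:: 1; 2];
    RwR (NatL gm2 0) [:: 0; 2; 3]].
Qed.

Let phi21_mul1 : phi21 ∘ (id2 ⊗ m1) = (m1 ⊗ id2) ∘ (id1 ⊗ phi21) ∘ (phi21 ⊗ id1).
Proof.
diagram (tt, phi21E, module_algebra_l, coassoc2)
  [:: Rw 0 [:: 0]; Rw (NatR 1 gm1) [:: 1; 2]; Rw 1 [:: 0; 1]; Rw 2 [:: 6; 7];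
    Rw (NatL gDelta2 0) [:: 4; 5; 6]]
  [:: Rw 0 [:: 1]; Rw 0 [:: 4]].
Qed.

(** This law and the next are not the duals of the two above: the opposite datum has a trivial
    coaction, not a trivial action. Here both coactions are arbitrary and [phi12] keeps its full
    form. *)
Let phi12_Delta2 : (Delta2 ⊗ id1) ∘ phi12 = (id2 ⊗ phi12) ∘ (phi12 ⊗ id2) ∘ (id1 ⊗ Delta2).
Proof.
diagram (tt, phi12E, Delta_mul2, nu_l_Delta, comodule_coalgebra_r,
    comodule_algebra_l, assoc2, assoc1)
  [:: Rw 0 [:: 1]; Rw 1 [:: 1; 2]; RwR (NatR 0 gDelta2) [:: 4; 5];
    Rw 2 [:: 8; 9]; Rw 3 [:: 6; 7]; Rw (NatL gnu_l 1) [:: 9; 10; 13]]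
  [:: Rw 0 [:: 0]; Rw 0 [:: 5]; Rw 4 [:: 4; 5]; Rw (NatL gm1 1) [:: 2; 4];
    Rw 5 [:: 2; 6]; Rw 6 [:: 0; 1]; RwR (NatR 0 gm2) [:: 3; 4; 7]].
Qed.

Let phi12_Delta1 : (id2 ⊗ Delta1) ∘ phi12 = (phi12 ⊗ id1) ∘ (id1 ⊗ phi12) ∘ (Delta1 ⊗ id2).
Proof.
diagram (tt, phi12E, algebra_coalgebra1, comodule_coalgebra_l, nu_r_Delta,
    comodule_algebra_r, assoc1, assoc2, nu_l_Delta)
  [:: Rw 0 [:: 1]; Rw 1 [:: 0; 1]; RwR (NatL gDelta1 1) [:: 6; 8];
    Rw 3 [:: 4; 9]; Rw 2 [:: 10; 11]; Rw 6 [:: 5; 11]]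
  [:: Rw 0 [:: 0]; Rw 0 [:: 4]; Rw 4 [:: 4; 5]; Rw (NatR 0 gm2) [:: 5; 6];
    RwR (NatR 0 gnu_r) [:: 9; 10]; RwR 5 [:: 1; 2]; Rw 7 [:: 15; 16];
    RwR (NatL gm1 1) [:: 4; 7; 8]; Rw (NatL gnu_l 1) [:: 7; 8; 11]].
Qed.

Let phi21_eta2 : phi21 ∘ (eta2 ⊗ id1) = id1 ⊗ eta2.
Proof.
diagram (tt, phi21E, Delta_eta2, mu_l_unit)
  [:: Rw 0 [:: 0]; Rw 1 [:: 2; 3]; Rw (NatL geta2 0) [:: 1; 2];
    Rw 2 [:: 1; 2]]
  [::].
Qed.

Let phi21_eta1 : phi21 ∘ (id2 ⊗ eta1) = eta1 ⊗ id2.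
Proof.
diagram (tt, phi21E, mu_l_eta1, counitl2)
  [:: Rw 0 [:: 0]; Rw (NatR 1 geta1) [:: 1; 2]; Rw 1 [:: 0; 1];
    Rw 2 [:: 0; 1]]
  [::].
Qed.

Let phi12_eps2 : (eps2 ⊗ id1) ∘ phi12 = id1 ⊗ eps2.
Proof.
diagram (tt, phi12E, eps_mul2, nu_l_counit, nu_r_eps2, unitr1)
  [:: Rw 0 [:: 1]; Rw 1 [:: 1; 2]; RwR (NatR 0 geps2) [:: 1; 2];
    Rw 2 [:: 3; 4]; Rw 3 [:: 1; 2]; Rw 4 [:: 1; 2]]
  [::].
Qed.

Let phi12_eps1 : (id2 ⊗ eps1) ∘ phi12 = eps1 ⊗ id2.
Proof.
diagram (tt, phi12E, eps_mul1, nu_r_counit, nu_l_eps1, unitl2)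
  [:: Rw 0 [:: 1]; Rw 1 [:: 0; 1]; RwR (NatL geps1 1) [:: 1; 3];
    Rw 2 [:: 0; 2]; Rw 3 [:: 1; 2]; Rw 4 [:: 0; 2]]
  [::].
Qed.

Let phi21_eps1 : (eps1 ⊗ id2) ∘ phi21 = id2 ⊗ eps1.
Proof.
diagram (tt, phi21E, eps1_mu_l, counitl2)
  [:: Rw 0 [:: 1]; Rw 1 [:: 0; 1]; RwR (NatR 1 geps1) [:: 0; 1];
    Rw 2 [:: 1; 2]]
  [::].
Qed.

Let phi21_eps : (eps1 ⊗ eps2) ∘ phi21 = eps2 ⊗ eps1.
Proof.
diagram (tt, phi21_eps1) [:: Rw 0 [:: 1; 2]] [::].
Qed.

Let phi12_eta : phi12 ∘ (eta1 ⊗ eta2) = eta2 ⊗ eta1.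
Proof.
diagram (tt, phi12E, nu_l_eta1, nu_r_eta2, unitr1, unitl2)
  [:: Rw 0 [:: 0]; Rw 1 [:: 5; 6]; Rw (NatL geta1 1) [:: 2; 5];
    Rw 4 [:: 2; 5]; Rw 2 [:: 2; 3]; Rw 3 [:: 0; 1]]
  [::].
Qed.

Let DeltaB_mul12 : DeltaB = mBB ∘ (D1 ⊗ D2).
Proof.
diagram (tt, phi12E, unitr1, unitl2, phi21_eta2, phi21_eta1)
  [:: Rw 0 [:: 0]]
  [:: Rw (NatR 1 geta1) [:: 11; 12]; Rw (NatR 0 geta1) [:: 11; 12];
    Rw 4 [:: 10; 11]; Rw 1 [:: 10; 11]; Rw (NatL geta2 1) [:: 5; 8];
    Rw 3 [:: 2; 3]; Rw 2 [:: 0; 1]].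
Qed.

Let DeltaB_mul11 : D1 ∘ m1 = mBB ∘ (D1 ⊗ D1).
Proof.
diagram (tt, phi21E, nu_l_Delta, comodule_algebra_l, algebra_coalgebra1,
    unitr2, phi21_eta2)
  [:: Rw 3 [:: 2; 3]; Rw 2 [:: 1; 2]]
  [:: Rw 4 [:: 0; 1]; Rw (NatL geta2 0) [:: 9; 11];
    Rw (NatL geta2 1) [:: 4; 6]; Rw 5 [:: 1; 2]; Rw 0 [:: 6]; Rw 1 [:: 10; 11];
    Rw (NatL gnu_l 0) [:: 7; 8; 10]].
Qed.

Let DeltaB_mul22 : D2 ∘ m2 = mBB ∘ (D2 ⊗ D2).
Proof.
diagram (tt, phi21E, coassoc2, comodule_algebra_r, Delta_mul2, unitl1,
    phi21_eta1)
  [:: Rw 3 [:: 1; 2]; Rw 2 [:: 1; 2]]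
  [:: Rw 4 [:: 8; 15]; Rw (NatR 1 geta1) [:: 10; 11];
    Rw (NatR 0 geta1) [:: 9; 10]; Rw 5 [:: 8; 9]; Rw 0 [:: 2];
    RwR (NatL gDelta2 1) [:: 4; 7]; RwR 1 [:: 10; 12];
    Rw (NatR 1 gnu_r) [:: 3; 7; 8]].
Qed.

(** The case where the twist meets the coproduct. On the left [module_coalgebra_l] and
    [comodule_algebra_l] bring out a copy of phi12 ∘ phi21, which [module_comodule] replaces; on the
    right [comodule_coalgebra_r] leads to the same diagram. *)
Let DeltaB_mul21 : DeltaB ∘ phi21 = mBB ∘ (D2 ⊗ D1).
Proof.
diagram (tt, phi21E, phi12E, module_coalgebra_l, module_comodule,
    comodule_coalgebra_r, comodule_algebra_l, coassoc2, assoc1, assoc2,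
    unitl1, unitr2)
  [:: Rw 0 [:: 3]; Rw 1 [:: 0]; Rw 2 [:: 6; 7]; Rw 5 [:: 5; 6];
    Rw (NatL gm1 1) [:: 2; 5]; RwR (NatL gDelta2 0) [:: 6; 16];
    RwR (NatR 1 gDelta1) [:: 14; 15]; RwR 6 [:: 18; 21]; Rw 6 [:: 19; 20];
    Rw (NatL gDelta2 0) [:: 14; 15; 18]; Rw 8 [:: 2; 6]; Rw 7 [:: 0; 1];
    RwR (NatR 0 gm2) [:: 3; 4; 7]; Rw 3 [:: 1; 4; 5; 6; 7; 8; 9; 10]]
  [:: Rw 9 [:: 8; 15]; Rw 10 [:: 0; 1]; Rw 0 [:: 6]; Rw 4 [:: 11; 12];
    Rw (NatL gm1 0) [:: 8; 11]; Rw (NatL gm1 1) [:: 3; 6];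
    Rw (NatL gm2 0) [:: 9; 14]; Rw 0 [:: 1]; RwR (NatL gDelta2 1) [:: 3; 8];
    Rw (NatR 1 gnu_l) [:: 2; 8; 9]; RwR (NatL gDelta2 0) [:: 9; 16];
    Rw (NatR 1 gDelta1) [:: 8; 16; 17];
    Rw (NatL (EPsi (OVar 0) (OVar 1)) 0) [:: 11; 12; 18]; Rw 7 [:: 0; 2];
    Rw 8 [:: 3; 8]; RwR 6 [:: 18; 23]; Rw 6 [:: 21; 22];
    RwR (NatR 0 gm2) [:: 4; 5; 9]; Rw (NatL gnu_l 0) [:: 10; 11; 19];
    Rw (NatL gnu_r 0) [:: 12; 13; 17]; Rw (NatL gDelta2 0) [:: 13; 14; 17]].
Qed.

Let DeltaB_mB : DeltaB ∘ mB = mBB ∘ (DeltaB ⊗ DeltaB).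
Proof.
apply: (@multiplicative_on_factors C B1 B2 (B1 ⊗ B2 ⊗ (B1 ⊗ B2))%ob
  m1 m2 phi21 DeltaB D1 D2 mBB); try typing; try by [].
apply: tensor_square_assoc; first by typing.
diagram (tt, phi21_mul2, phi21_mul1, assoc1, assoc2)
  [:: Rw 2 [:: 1; 4]; Rw 0 [:: 3; 4]]
  [:: RwR 3 [:: 0; 1]; Rw 1 [:: 3; 4]].
Qed.

Lemma trivial_mu_r_bialgebra : is_bialgebra (cross_product B1 B2 phi12 phi21).
Proof.
split.
- split=> /=; first by split; typing.
  + diagram (tt, phi21_mul2, phi21_mul1, assoc1, assoc2)
      [:: Rw 2 [:: 1; 4]; Rw 0 [:: 3; 4]]
      [:: RwR 3 [:: 0; 1]; Rw 1 [:: 3; 4]].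
  + diagram (tt, phi21_eta2, unitl1, unitl2)
      [:: Rw 1 [:: 1; 4]; Rw 0 [:: 1; 2]; Rw 2 [:: 0; 1]]
      [::].
  + diagram (tt, phi21_eta1, unitr1, unitr2)
      [:: Rw 2 [:: 0; 1]; Rw 0 [:: 1; 2]; Rw 1 [:: 0; 1]]
      [::].
- split=> /=; first by split; typing.
  + diagram (tt, phi12_Delta2, phi12_Delta1, coassoc1, coassoc2)
      [:: Rw 2 [:: 4; 5]; Rw 0 [:: 1; 2]]
      [:: RwR 3 [:: 1; 4]; Rw 1 [:: 1; 2]].
  + diagram (tt, phi12_eps2, counitl1, counitl2)
      [:: Rw 1 [:: 3; 4]; Rw 0 [:: 0; 1]; Rw 2 [:: 0; 1]]
      [::].
  + diagram (tt, phi12_eps1, counitr1, counitr2)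
      [:: Rw 2 [:: 0; 3]; Rw 0 [:: 0; 1]; Rw 1 [:: 0; 1]]
      [::].
- exact: DeltaB_mB.
- split=> /=; first by typing.
  + diagram (tt, eps_mul1, eps_mul2, phi21_eps)
      [:: Rw 0 [:: 2; 3]; Rw 1 [:: 0; 1]]
      [:: RwR 2 [:: 1; 2]].
  + diagram (tt, eps_eta1, eps_eta2) [:: Rw 0 [:: 2; 3]; Rw 1 [:: 0; 1]] [::].
- split=> /=; first by typing.
  + diagram (tt, Delta_eta1, Delta_eta2, phi12_eta)
      [:: Rw 0 [:: 3; 4]; Rw 1 [:: 1; 2]]
      [:: RwR 2 [:: 1; 2]].
  + diagram (tt, eps_eta1, eps_eta2) [:: Rw 0 [:: 2; 3]; Rw 1 [:: 0; 1]] [::].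
Qed.

(** Triviality of mu_r enters through [phi21_eps1], which makes the projection multiplicative;
    comultiplicativity comes from the counit conditions on the coactions. *)
Lemma trivial_mu_r_projection :
  bialgebra_morphism (cross_product B1 B2 phi12 phi21) B2 (eps1 ⊗ id2).
Proof.
split; split=> /=; try typing.
- diagram (tt, phi21_eps1, eps_mul1) [:: Rw 1 [:: 1; 2]] [:: RwR 0 [:: 1]].
- diagram (tt, eps_eta1) [:: Rw 0 [:: 1; 2]] [::].
- diagram (tt, phi12_eps1, counitl1) [:: RwR 0 [:: 1]] [:: Rw 1 [:: 3; 4]].
- diagram tt [::] [::].
Qed.

End TrivialRightAction.

(** * Factorizations of a bialgebra *)

Record cross_factorization (C : braided_category) (A B1 B2 : prebialgebra C)
    (i1 i2 p1 p2 : Mor C) : Prop := {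
  cf_bialgebra : is_bialgebra A;
  cf_algebra1 : is_algebra B1;
  cf_coalgebra1 : is_coalgebra B1;
  cf_algebra2 : is_algebra B2;
  cf_coalgebra2 : is_coalgebra B2;
  cf_i1 : algebra_morphism B1 A i1;
  cf_i2 : algebra_morphism B2 A i2;
  cf_p1 : coalgebra_morphism A B1 p1;
  cf_p2 : coalgebra_morphism A B2 p2;
  cf_retract1 : p1 ∘ i1 = idm B1;
  cf_retract2 : p2 ∘ i2 = idm B2;
  cf_inverse_l : mul A ∘ (i1 ⊗ i2) ∘ ((p1 ⊗ p2) ∘ Delta A) = idm A;
  cf_inverse_r : (p1 ⊗ p2) ∘ Delta A ∘ (mul A ∘ (i1 ⊗ i2)) = idm (B1 ⊗ B2)
}.

Section Factorization.
Variable C : braided_category.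
Variables (A B1 B2 : prebialgebra C) (i1 i2 p1 p2 : Mor C).
Hypothesis cf : cross_factorization A B1 B2 i1 i2 p1 p2.

Local Notation idA := (idm A).
Local Notation id1 := (idm B1).
Local Notation id2 := (idm B2).
Local Notation mA := (mul A).
Local Notation m1 := (mul B1).
Local Notation m2 := (mul B2).
Local Notation etaA := (eta A).
Local Notation eta1 := (eta B1).
Local Notation eta2 := (eta B2).
Local Notation DeltaA := (Delta A).
Local Notation Delta1 := (Delta B1).
Local Notation Delta2 := (Delta B2).
Local Notation epsA := (eps A).
Local Notation eps1 := (eps B1).
Local Notation eps2 := (eps B2).

Let algA : is_algebra A. Proof. by case: (cf_bialgebra cf). Qed.
Let coalgA : is_coalgebra A. Proof. by case: (cf_bialgebra cf). Qed.
Let hmA : hom (A ⊗ A) A mA. Proof. by case: algA => [[]]. Qed.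
Let hetaA : hom unit_ob A etaA. Proof. by case: algA => [[]]. Qed.
Let hDeltaA : hom A (A ⊗ A) DeltaA. Proof. by case: coalgA => [[]]. Qed.
Let hepsA : hom A unit_ob epsA. Proof. by case: coalgA => [[]]. Qed.
Let hm1 : hom (B1 ⊗ B1) B1 m1. Proof. by case: (cf_algebra1 cf) => [[]]. Qed.
Let heta1 : hom unit_ob B1 eta1. Proof. by case: (cf_algebra1 cf) => [[]]. Qed.
Let hDelta1 : hom B1 (B1 ⊗ B1) Delta1.
Proof. by case: (cf_coalgebra1 cf) => [[]]. Qed.
Let heps1 : hom B1 unit_ob eps1. Proof. by case: (cf_coalgebra1 cf) => [[]]. Qed.
Let hm2 : hom (B2 ⊗ B2) B2 m2. Proof. by case: (cf_algebra2 cf) => [[]]. Qed.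
Let heta2 : hom unit_ob B2 eta2. Proof. by case: (cf_algebra2 cf) => [[]]. Qed.
Let hDelta2 : hom B2 (B2 ⊗ B2) Delta2.
Proof. by case: (cf_coalgebra2 cf) => [[]]. Qed.
Let heps2 : hom B2 unit_ob eps2. Proof. by case: (cf_coalgebra2 cf) => [[]]. Qed.
Let hi1 : hom B1 A i1. Proof. by case: (cf_i1 cf). Qed.
Let hi2 : hom B2 A i2. Proof. by case: (cf_i2 cf). Qed.
Let hp1 : hom A B1 p1. Proof. by case: (cf_p1 cf). Qed.
Let hp2 : hom A B2 p2. Proof. by case: (cf_p2 cf). Qed.

Local Tactic Notation "diagram" constr(rules) uconstr(s1) uconstr(s2) :=
  diagram_in C [:: carrier A; carrier B1; carrier B2]
    (tt, hmA, hetaA, hDeltaA, hepsA, hm1, heta1, hDelta1, heps1,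
     hm2, heta2, hDelta2, heps2, hi1, hi2, hp1, hp2) rules s1 s2.
Local Ltac typing :=
  typing_in C [:: carrier A; carrier B1; carrier B2]
    (tt, hmA, hetaA, hDeltaA, hepsA, hm1, heta1, hDelta1, heps1,
     hm2, heta2, hDelta2, heps2, hi1, hi2, hp1, hp2).

Local Notation gDeltaA := (EGen 2).
Local Notation gi1 := (EGen 12).
Local Notation gp1 := (EGen 14).
Local Notation gp2 := (EGen 15).

Let assoc : mA ∘ (mA ⊗ idA) = mA ∘ (idA ⊗ mA). Proof. by case: algA. Qed.
Let unitl : mA ∘ (etaA ⊗ idA) = idA. Proof. by case: algA. Qed.
Let unitr : mA ∘ (idA ⊗ etaA) = idA. Proof. by case: algA. Qed.
Let coassoc : (DeltaA ⊗ idA) ∘ DeltaA = (idA ⊗ DeltaA) ∘ DeltaA.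
Proof. by case: coalgA. Qed.
Let counitl : (epsA ⊗ idA) ∘ DeltaA = idA. Proof. by case: coalgA. Qed.
Let counitr : (idA ⊗ epsA) ∘ DeltaA = idA. Proof. by case: coalgA. Qed.
Let Delta_mulA : DeltaA ∘ mA =
  (mA ⊗ mA) ∘ (idA ⊗ Psi A A ⊗ idA) ∘ (DeltaA ⊗ DeltaA).
Proof. by case: (cf_bialgebra cf). Qed.
Let eps_mulA : epsA ∘ mA = epsA ⊗ epsA.
Proof. case: (cf_bialgebra cf) => _ _ _ [_ -> _] _ /=; diagram tt [::] [::]. Qed.
Let eps_etaA : epsA ∘ etaA = idm unit_ob.
Proof. by case: (cf_bialgebra cf) => _ _ _ []. Qed.
Let Delta_etaA : DeltaA ∘ etaA = etaA ⊗ etaA.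
Proof. case: (cf_bialgebra cf) => _ _ _ _ [_ -> _] /=; diagram tt [::] [::]. Qed.
Let i1_mul : i1 ∘ m1 = mA ∘ (i1 ⊗ i1). Proof. by case: (cf_i1 cf). Qed.
Let i2_mul : i2 ∘ m2 = mA ∘ (i2 ⊗ i2). Proof. by case: (cf_i2 cf). Qed.
Let i1_eta : i1 ∘ eta1 = etaA. Proof. by case: (cf_i1 cf). Qed.
Let i2_eta : i2 ∘ eta2 = etaA. Proof. by case: (cf_i2 cf). Qed.
Let p1_Delta : Delta1 ∘ p1 = (p1 ⊗ p1) ∘ DeltaA. Proof. by case: (cf_p1 cf). Qed.
Let p2_Delta : Delta2 ∘ p2 = (p2 ⊗ p2) ∘ DeltaA. Proof. by case: (cf_p2 cf). Qed.
Let p1_eps : eps1 ∘ p1 = epsA. Proof. by case: (cf_p1 cf). Qed.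
Let p2_eps : eps2 ∘ p2 = epsA. Proof. by case: (cf_p2 cf). Qed.
Let retract1 : p1 ∘ i1 = id1. Proof. exact: cf_retract1 cf. Qed.
Let retract2 : p2 ∘ i2 = id2. Proof. exact: cf_retract2 cf. Qed.
Let inverse_l : mA ∘ (i1 ⊗ i2) ∘ ((p1 ⊗ p2) ∘ DeltaA) = idA.
Proof. exact: cf_inverse_l cf. Qed.
Let inverse_r : (p1 ⊗ p2) ∘ DeltaA ∘ (mA ∘ (i1 ⊗ i2)) = idm (B1 ⊗ B2).
Proof. exact: cf_inverse_r cf. Qed.

Let mul1E : m1 = p1 ∘ mA ∘ (i1 ⊗ i1).
Proof.
diagram (tt, i1_mul, retract1) [:: InsR 1 0 0] [:: RwR 0 [:: 1; 2; 3]].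
Qed.
Let Delta1E : Delta1 = (p1 ⊗ p1) ∘ DeltaA ∘ i1.
Proof.
diagram (tt, p1_Delta, retract1) [:: InsR 1 1 0] [:: RwR 0 [:: 0; 1; 2]].
Qed.
(** i1 is only an algebra morphism, but it is a section of p1, which preserves the counit. In the
    same way p1 and p2 preserve the unit, and the counit and unit of each factor turn out to be
    compatible with its product and coproduct. *)
Let eps_i1 : epsA ∘ i1 = eps1.
Proof.
diagram (tt, p1_eps, retract1) [:: RwR 0 [:: 0]] [:: InsR 1 1 0].
Qed.
Let eps_i2 : epsA ∘ i2 = eps2.
Proof.
diagram (tt, p2_eps, retract2) [:: RwR 0 [:: 0]] [:: InsR 1 1 0].
Qed.
Let p1_eta : p1 ∘ etaA = eta1.
Proof.
diagram (tt, i1_eta, retract1) [:: RwR 0 [:: 1]] [:: InsR 1 0 0].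
Qed.
Let p2_eta : p2 ∘ etaA = eta2.
Proof.
diagram (tt, i2_eta, retract2) [:: RwR 0 [:: 1]] [:: InsR 1 0 0].
Qed.
Let eps_mul1 : eps1 ∘ m1 = eps1 ⊗ eps1.
Proof.
diagram (tt, eps_mulA, i1_mul, eps_i1)
  [:: RwR 2 [:: 0]; Rw 1 [:: 1; 2]; Rw 0 [:: 0; 1]]
  [:: RwR 2 [:: 0]; RwR 2 [:: 2]].
Qed.
Let eps_mul2 : eps2 ∘ m2 = eps2 ⊗ eps2.
Proof.
diagram (tt, eps_mulA, i2_mul, eps_i2)
  [:: RwR 2 [:: 0]; Rw 1 [:: 1; 2]; Rw 0 [:: 0; 1]]
  [:: RwR 2 [:: 0]; RwR 2 [:: 2]].
Qed.
Let Delta_eta1 : Delta1 ∘ eta1 = eta1 ⊗ eta1.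
Proof.
diagram (tt, Delta_etaA, p1_Delta, p1_eta)
  [:: RwR 2 [:: 1]; Rw 1 [:: 0; 1]; Rw 0 [:: 2; 3]]
  [:: RwR 2 [:: 0]; RwR 2 [:: 2]].
Qed.
Let Delta_eta2 : Delta2 ∘ eta2 = eta2 ⊗ eta2.
Proof.
diagram (tt, Delta_etaA, p2_Delta, p2_eta)
  [:: RwR 2 [:: 1]; Rw 1 [:: 0; 1]; Rw 0 [:: 2; 3]]
  [:: RwR 2 [:: 0]; RwR 2 [:: 2]].
Qed.

(** Apply the counit of B2 to [inverse_r]; the three companions apply the counit of B1 or insert a
    unit. *)
Let p1_mul_i1i2 : p1 ∘ mA ∘ (i1 ⊗ i2) = id1 ⊗ eps2.
Proof.
diagram (tt, inverse_r, counitr, p2_eps) [:: InsR 1 1 0; RwR 2 [:: 0]] [::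
    InsR 0 1 0].
Qed.
Let p2_mul_i1i2 : p2 ∘ mA ∘ (i1 ⊗ i2) = eps1 ⊗ id2.
Proof.
diagram (tt, inverse_r, counitl, p1_eps) [:: InsR 1 1 0; RwR 2 [:: 1]] [::
    InsR 0 1 0].
Qed.
Let Delta_i1_p1p2 : (p1 ⊗ p2) ∘ DeltaA ∘ i1 = id1 ⊗ eta2.
Proof.
diagram (tt, inverse_r, unitr, i2_eta) [:: InsR 1 3 0] [:: InsR 0 0 0; Rw 2
    [:: 4; 5]].
Qed.
Let Delta_i2_p1p2 : (p1 ⊗ p2) ∘ DeltaA ∘ i2 = eta1 ⊗ id2.
Proof.
diagram (tt, inverse_r, unitl, i1_eta) [:: InsR 1 3 0] [:: InsR 0 0 0; Rw 2
    [:: 5; 6]].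
Qed.
(** By [inverse_l] an element of A is a product of an element of B1 by one of B2. A further right
    factor from B2 merges with the latter, and p1 turns their product into a counit. *)
Let p1_mul_i2 : p1 ∘ mA ∘ (idA ⊗ i2) = p1 ⊗ eps2.
Proof.
diagram (tt, inverse_l, p1_mul_i1i2, assoc, i2_mul, eps_mul2)
  [:: InsR 0 2 0; Rw 2 [:: 1; 3]; RwR 3 [:: 2; 3; 4]]
  [:: InsR 0 2 0; Rw 1 [:: 1; 2; 3; 5]; RwR 4 [:: 0; 1]; RwR 1 [:: 0]].
Qed.
Let p2_mul_i1 : p2 ∘ mA ∘ (i1 ⊗ idA) = eps1 ⊗ p2.
Proof.
diagram (tt, inverse_l, p2_mul_i1i2, assoc, i1_mul, eps_mul1)
  [:: InsR 0 2 1; RwR 2 [:: 1; 2]; RwR 3 [:: 4; 5; 8]]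
  [:: InsR 0 1 0; Rw 1 [:: 0; 1; 2; 4]; RwR 4 [:: 1; 4]; RwR 1 [:: 1]].
Qed.
Let Delta_i1_p2 : (idA ⊗ p2) ∘ DeltaA ∘ i1 = i1 ⊗ eta2.
Proof.
diagram (tt, inverse_l, Delta_i1_p1p2, coassoc, p2_Delta, Delta_eta2)
  [:: InsR 0 0 0; Rw 2 [:: 6; 7]; RwR 3 [:: 0; 3; 4]; Rw 1 [:: 3; 5; 6; 7]]
  [:: InsR 0 0 0; Rw 1 [:: 3; 5; 6; 7]; RwR 4 [:: 0; 3]].
Qed.
Let Delta_i2_p1 : (p1 ⊗ idA) ∘ DeltaA ∘ i2 = eta1 ⊗ i2.
Proof.
diagram (tt, inverse_l, Delta_i2_p1p2, coassoc, p1_Delta, Delta_eta1)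
  [:: InsR 0 0 1; RwR 2 [:: 5; 7]; RwR 3 [:: 4; 5; 6]; Rw 1 [:: 2; 5; 6; 7]]
  [:: InsR 0 0 1; Rw 1 [:: 2; 4; 5; 6]; RwR 4 [:: 3; 4]].
Qed.
(** Factor the second argument by [inverse_l]: its B2-part stands on the right, where p1 sees only
    its counit. *)
Let p1_mul_absorb : p1 ∘ mA = p1 ∘ mA ∘ (idA ⊗ (i1 ∘ p1)).
Proof.
diagram (tt, inverse_l, p1_mul_i2, assoc, counitr, p2_eps)
  [:: InsR 0 2 1; RwR 2 [:: 1; 2]; Rw 1 [:: 0; 1; 2]; Rw 4 [:: 0; 1];
    Rw 3 [:: 0; 5]]
  [::].
Qed.
Let p2_mul_absorb : p2 ∘ mA = p2 ∘ mA ∘ ((i2 ∘ p2) ⊗ idA).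
Proof.
diagram (tt, inverse_l, p2_mul_i1, assoc, counitl, p1_eps)
  [:: InsR 0 2 0; Rw 2 [:: 1; 2]; Rw 1 [:: 0; 1; 5]; Rw 4 [:: 4; 5];
    Rw 3 [:: 4; 5]]
  [::].
Qed.
Let Delta_i1_absorb : DeltaA ∘ i1 = (idA ⊗ (i1 ∘ p1)) ∘ DeltaA ∘ i1.
Proof.
diagram (tt, inverse_l, Delta_i1_p2, coassoc, unitr, i2_eta)
  [:: InsR 0 0 1; RwR 2 [:: 5; 6]; Rw 1 [:: 2; 6; 7]; Rw 4 [:: 1; 2];
    Rw 3 [:: 0; 1]]
  [::].
Qed.
Let Delta_i2_absorb : DeltaA ∘ i2 = ((i2 ∘ p2) ⊗ idA) ∘ DeltaA ∘ i2.
Proof.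
diagram (tt, inverse_l, Delta_i2_p1, coassoc, unitl, i1_eta)
  [:: InsR 0 0 0; Rw 2 [:: 5; 6]; Rw 1 [:: 5; 6; 7]; Rw 4 [:: 5; 6];
    Rw 3 [:: 0; 5]]
  [::].
Qed.
Let p1_linear : p1 ∘ mA ∘ (i1 ⊗ idA) = m1 ∘ (id1 ⊗ p1).
Proof.
diagram (tt, p1_mul_absorb, mul1E) [:: Rw 0 [:: 0; 1]] [:: Rw 1 [:: 0]].
Qed.
Let p2_linear : p2 ∘ mA ∘ (idA ⊗ i2) = m2 ∘ (p2 ⊗ id2).
Proof.
diagram (tt, p2_mul_absorb, i2_mul, retract2)
  [:: Rw 0 [:: 0; 1]; RwR 1 [:: 1; 2; 3]; Rw 2 [:: 0; 1]]
  [::].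
Qed.
Let i1_colinear : (p1 ⊗ idA) ∘ DeltaA ∘ i1 = (id1 ⊗ i1) ∘ Delta1.
Proof.
diagram (tt, Delta_i1_absorb, Delta1E) [:: Rw 0 [:: 1; 2]] [:: Rw 1 [:: 1]].
Qed.
Let i2_colinear : (idA ⊗ p2) ∘ DeltaA ∘ i2 = (i2 ⊗ id2) ∘ Delta2.
Proof.
diagram (tt, Delta_i2_absorb, p2_Delta, retract2)
  [:: Rw 0 [:: 1; 2]; RwR 1 [:: 0; 2; 3]; Rw 2 [:: 2; 3]]
  [::].
Qed.

Local Notation mu_l := (p1 ∘ mA ∘ (i2 ⊗ i1)).
Local Notation mu_r := (p2 ∘ mA ∘ (i2 ⊗ i1)).
Local Notation nu_l := ((p2 ⊗ p1) ∘ DeltaA ∘ i1).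
Local Notation nu_r := ((p2 ⊗ p1) ∘ DeltaA ∘ i2).
Local Notation phi21 := (hd_phi21 B1 B2 mu_l mu_r).

(* For a, b in A, write a = i1 p1 a_(1) * i2 p2 a_(2); then p1 (a * b) is the product
   of p1 a_(1) by p1 (i2 p2 a_(2) * b). *)
Let p1_mul : p1 ∘ mA = m1 ∘ (id1 ⊗ mu_l) ∘ (p1 ⊗ p2 ⊗ id1) ∘ (DeltaA ⊗ p1).
Proof.
diagram (tt, p1_mul_absorb, p1_linear, assoc, inverse_l)
  [:: Rw 0 [:: 0; 1]]
  [:: RwR 1 [:: 0; 1]; RwR 2 [:: 1; 2]; Rw 3 [:: 4; 5; 6; 7; 8; 9]].
Qed.
Let p2_mul : p2 ∘ mA = m2 ∘ (mu_r ⊗ id2) ∘ (id2 ⊗ p1 ⊗ p2) ∘ (p2 ⊗ DeltaA).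
Proof.
diagram (tt, p2_mul_absorb, p2_linear, assoc, inverse_l)
  [:: Rw 0 [:: 0; 1]]
  [:: RwR 1 [:: 0; 2]; Rw 2 [:: 1; 4]; Rw 3 [:: 2; 3; 4; 5; 6; 7]].
Qed.

Lemma factorization_eps1 : algebra_morphism B1 unit_prebialgebra eps1.
Proof.
split=> /=; first by [].
- diagram (tt, eps_mul1) [:: Rw 0 [:: 0; 1]] [::].
- diagram (tt, i1_eta, eps_i1, eps_etaA)
    [:: RwR 1 [:: 0]; Rw 0 [:: 1; 2]; Rw 2 [:: 0; 1]]
    [::].
Qed.

Lemma factorization_left_module : left_module B2 B1 mu_l.
Proof.
split; first by typing.
- diagram (tt, assoc, i2_mul, p1_mul_absorb)
    [:: Rw 1 [:: 3; 4]; Rw 0 [:: 1; 3]]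
    [:: RwR 2 [:: 0; 1; 2; 3]].
- diagram (tt, i2_eta, unitl, retract1)
    [:: Rw 0 [:: 3; 4]; Rw 1 [:: 1; 3]; Rw 2 [:: 0; 1]]
    [::].
Qed.

Let p2i1 : p2 ∘ i1 = eta2 ∘ eps1.
Proof.
diagram (tt, unitr, p2_mul_i1, p2_eta)
  [:: InsR 0 1 0; Rw 1 [:: 0; 1; 3]; Rw 2 [:: 0; 1]]
  [::].
Qed.

Lemma factorization_mu_r_eta : mu_r ∘ (eta2 ⊗ id1) = eta2 ∘ eps1.
Proof.
diagram (tt, i2_eta, unitl, p2i1)
  [:: Rw 0 [:: 3; 4]; Rw 1 [:: 1; 3]]
  [:: RwR 2 [:: 0; 1]].
Qed.

Lemma factorization_eps_mu_r : eps2 ∘ mu_r = eps2 ⊗ eps1.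
Proof.
diagram (tt, p2_eps, eps_mulA, eps_i1, eps_i2)
  [:: Rw 0 [:: 0; 1]; Rw 1 [:: 0; 1]]
  [:: RwR 2 [:: 0]; RwR 3 [:: 2]].
Qed.

Lemma factorization_algebra_coalgebra1 :
  Delta1 ∘ m1 =
    (m1 ⊗ m1) ∘ (id1 ⊗ mu_l ⊗ id1 ⊗ id1) ∘ (id1 ⊗ id2 ⊗ Psi B1 B1 ⊗ id1)
      ∘ (id1 ⊗ nu_l ⊗ id1 ⊗ id1) ∘ (Delta1 ⊗ Delta1).
Proof.
diagram (tt, mul1E, p1_Delta, Delta_mulA, p1_mul, Delta_i1_absorb, p1_linear,
    Delta1E, i1_colinear, coassoc)
  [:: Rw 0 [:: 1]; Rw 1 [:: 0; 1]; Rw 2 [:: 2; 3]; Rw 4 [:: 7; 8];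
    Rw (NatL gi1 0) [:: 4; 7]; Rw 5 [:: 0; 1; 2]; Rw 3 [:: 2; 3]]
  [:: Rw 6 [:: 6]; Rw (NatR 1 gp1) [:: 6; 7]; RwR 7 [:: 14; 15];
    RwR 8 [:: 13; 15]].
Qed.

(** The twist is the product of A taken in the wrong order, B2 before B1, and read in B1 ⊗ B2
    through the inverse of m_A (i_1 ⊗ i_2). *)
Lemma factorization_phi21 : (p1 ⊗ p2) ∘ DeltaA ∘ mA ∘ (i2 ⊗ i1) = phi21.
Proof.
rewrite /hd_phi21.
diagram (tt, Delta_mulA, p1_mul_absorb, p2_mul_absorb, i1_colinear, i2_colinear)
  [:: Rw 0 [:: 2; 3]; Rw 1 [:: 2; 3]; RwR (NatR 0 gp1) [:: 5; 6];
    Rw 3 [:: 6; 7; 8]]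
  [:: RwR 4 [:: 9; 10]; Rw (NatL gp2 1) [:: 7; 9]; RwR 2 [:: 0; 1; 3; 4]].
Qed.

(** The left-hand side is phi12 ∘ phi21 after cancelling the inverse pair between the two twists. *)
Lemma factorization_module_comodule :
  (p2 ⊗ p1) ∘ DeltaA ∘ mA ∘ (i2 ⊗ i1) =
    (m2 ⊗ m1) ∘ (mu_r ⊗ Psi B1 B2 ⊗ mu_l) ∘ (id2 ⊗ Psi B1 B1 ⊗ Psi B2 B2 ⊗ id1)
      ∘ (nu_r ⊗ Psi B2 B1 ⊗ nu_l) ∘ (Delta2 ⊗ Delta1).
Proof.
diagram (tt, Delta_mulA, p1_mul, p2_mul, i1_colinear, i2_colinear, coassoc)
  [:: Rw 0 [:: 2; 3]; Rw 2 [:: 2; 3]; RwR (NatR 0 gDeltaA) [:: 8; 9];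
    RwR (NatR 0 gp1) [:: 8; 9]; RwR (NatR 0 gp2) [:: 3; 4]; Rw 5 [:: 10; 11];
    Rw 3 [:: 10; 11; 12]; Rw 1 [:: 0; 1]]
  [:: Rw (NatL gp1 1) [:: 15; 18]; Rw (NatL gp1 2) [:: 7; 12];
    RwR 4 [:: 22; 23]; Rw (NatL gp2 1) [:: 17; 19]; Rw (NatL gp2 2) [:: 9; 13];
    Rw 5 [:: 22; 23]; Rw (NatL gDeltaA 1) [:: 17; 18; 20];
    Rw (NatL gDeltaA 2) [:: 9; 10; 14]].
Qed.

Lemma factorization_module_algebra_l :
  mu_l ∘ (id2 ⊗ m1) = m1 ∘ (id1 ⊗ mu_l) ∘ (phi21 ⊗ id1).
Proof.
rewrite -factorization_phi21.
diagram (tt, assoc, i1_mul, p1_mul, retract1)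
  [:: Rw 1 [:: 2; 3]; RwR 0 [:: 1; 2]; Rw 2 [:: 0; 1]; Rw 3 [:: 4; 5]]
  [::].
Qed.

Lemma factorization_module_coalgebra_l :
  Delta1 ∘ mu_l =
    (mu_l ⊗ m1) ∘ (id2 ⊗ Psi B1 B1 ⊗ mu_l) ∘ (nu_r ⊗ Psi B2 B1 ⊗ id1)
      ∘ (Delta2 ⊗ Delta1).
Proof.
diagram (tt, p1_Delta, Delta_mulA, p1_mul, Delta_i2_absorb, i2_colinear,
    p1_mul_absorb, coassoc, Delta1E)
  [:: Rw 0 [:: 0; 1]; Rw 1 [:: 2; 3]; Rw 5 [:: 2; 3];
    RwR (NatR 0 gp1) [:: 5; 6]; Rw 2 [:: 0; 1]; RwR 7 [:: 4; 13; 14; 15]]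
  [:: Rw (NatL gp1 1) [:: 8; 11]; RwR 3 [:: 12; 13; 14; 15];
    RwR 4 [:: 13; 14]; Rw (NatL gp2 1) [:: 10; 12]; Rw 6 [:: 13; 14];
    Rw (NatL gDeltaA 1) [:: 10; 11; 13]].
Qed.

Lemma factorization_mul_morphism phi :
  algebra_morphism (cross_product B1 B2 phi phi21) A (mA ∘ (i1 ⊗ i2)).
Proof.
split=> /=; first by typing.
- rewrite -factorization_phi21.
  diagram (tt, i1_mul, i2_mul, assoc, inverse_l)
    [:: Rw 0 [:: 4; 5]; Rw 2 [:: 0; 4]; Rw 1 [:: 2; 3]; RwR 2 [:: 1; 2];
      Rw 3 [:: 3; 4; 5; 6; 7; 8]]
    [:: Rw 2 [:: 0; 4]; RwR 2 [:: 1; 2]].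
- diagram (tt, i1_eta, i2_eta, unitl)
    [:: Rw 0 [:: 3; 4]; Rw 2 [:: 0; 3]]
    [:: RwR 1 [:: 0]].
Qed.

Lemma factorization_idempotent1 : is_idempotent A (i1 ∘ p1).
Proof.
split; first by typing.
diagram (tt, retract1) [:: Rw 0 [:: 1; 2]] [::].
Qed.

Lemma factorization_compatible1 : compatible_idempotent A (i1 ∘ p1).
Proof.
split.
- diagram (tt, i1_mul, retract1)
    [:: RwR 0 [:: 0; 1; 3]]
    [:: RwR 0 [:: 2; 3; 5]; Rw 1 [:: 1; 2]].
- diagram (tt, p1_eta, i1_eta) [:: Rw 0 [:: 1; 2]] [:: RwR 1 [:: 0]].
- diagram (tt, p1_Delta, retract1)
    [:: RwR 0 [:: 1; 3; 4]]
    [:: RwR 0 [:: 1; 3; 4]; Rw 1 [:: 3; 4]].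
- diagram (tt, p1_eps, eps_i1) [:: Rw 1 [:: 0; 1]] [:: RwR 0 [:: 0]].
Qed.

Lemma factorization_splitting :
  splitting (A ⊗ A) A ((i1 ∘ p1) ⊗ (i2 ∘ p2))
    (mA ∘ ((i1 ∘ p1) ⊗ (i2 ∘ p2))) (((i1 ∘ p1) ⊗ (i2 ∘ p2)) ∘ DeltaA).
Proof.
split; try typing.
- diagram (tt, inverse_l, retract1, retract2)
    [:: Rw 1 [:: 6; 7]; Rw 2 [:: 2; 3]; Rw 0 [:: 0; 1; 2; 3; 4; 5]]
    [::].
- diagram (tt, inverse_r) [:: Rw 0 [:: 1; 3; 4; 5; 6; 8]] [::].
Qed.

Let p1i2 : p1 ∘ i2 = eta1 ∘ eps2.
Proof.
diagram (tt, unitl, p1_mul_i2, p1_eta)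
  [:: InsR 0 1 0; Rw 1 [:: 0; 1; 2]]
  [:: RwR 2 [:: 1]].
Qed.

(** If i1 ∘ p1 is multiplicative, then p1 (i2 a * i1 x) is the product of p1 (i2 a) by x, and p1 ∘
    i2 is eta1 ∘ eps2. *)
Lemma factorization_trivial_mu_l :
  (i1 ∘ p1) ∘ mA = mA ∘ ((i1 ∘ p1) ⊗ (i1 ∘ p1)) -> mu_l = eps2 ⊗ id1.
Proof.
move=> Pi1alg.
diagram (tt, Pi1alg, p1i2, retract1, i1_eta, unitl)
  [:: InsR 2 0 0; Rw 0 [:: 1; 2; 3]; Rw 1 [:: 6; 7]; Rw 3 [:: 6; 7];
    Rw 4 [:: 1; 6]]
  [:: InsR 2 0 0; InsR 2 0 0].
Qed.

Lemma factorization_inverse : inverse (mA ∘ (i1 ⊗ i2)) ((p1 ⊗ p2) ∘ DeltaA).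
Proof.
have [df ch] : hom (B1 ⊗ B2) A (mA ∘ (i1 ⊗ i2)) by typing.
have [dg cg] : hom A (B1 ⊗ B2) ((p1 ⊗ p2) ∘ DeltaA) by typing.
by split; rewrite ?df ?dg ?ch ?cg.
Qed.

End Factorization.

Lemma op_factorization (C : braided_category) (A B1 B2 : prebialgebra C)
    (i1 i2 p1 p2 : Mor C) :
  cross_factorization A B1 B2 i1 i2 p1 p2 ->
  cross_factorization (op_pre A) (op_pre B1) (op_pre B2) p1 p2 i1 i2.
Proof.
case=> hA a1 c1 a2 c2 hi1 hi2 hp1 hp2 e1 e2 e3 e4; split=> //.
- exact/op_bialgebra.
- exact: op_algebra.
- exact: op_coalgebra.
- exact: op_algebra.
- exact: op_coalgebra.
- exact: op_algebra_morphism.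
- exact: op_algebra_morphism.
- exact: op_coalgebra_morphism.
- exact: op_coalgebra_morphism.
Qed.

Lemma mirror_factorization (C : braided_category) (A B1 B2 : prebialgebra C)
    (i1 i2 p1 p2 : Mor C) :
  cross_factorization A B1 B2 i1 i2 p1 p2 ->
  cross_factorization (mirror_pre A) (mirror_pre B2) (mirror_pre B1) i2 i1 p2 p1.
Proof.
case=> hA a1 c1 a2 c2 hi1 hi2 hp1 hp2 e1 e2 e3 e4; split=> //.
- exact/mirror_bialgebra.
- exact: mirror_algebra.
- exact: mirror_coalgebra.
- exact: mirror_algebra.
- exact: mirror_coalgebra.
Qed.

(** * The Hopf datum of a factorization *)

Section FactorizationHopfDatum.
Variable C : braided_category.
Variables (A B1 B2 : prebialgebra C) (i1 i2 p1 p2 : Mor C).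
Hypothesis cf : cross_factorization A B1 B2 i1 i2 p1 p2.

Local Notation mu_l := (p1 ∘ mul A ∘ (i2 ⊗ i1)).
Local Notation mu_r := (p2 ∘ mul A ∘ (i2 ⊗ i1)).
Local Notation nu_l := ((p2 ⊗ p1) ∘ Delta A ∘ i1).
Local Notation nu_r := ((p2 ⊗ p1) ∘ Delta A ∘ i2).

(** An identity proved for [cf] yields its dual, its mirror image and the dual of the latter from
    these three factorizations; so only one representative of each family of axioms was computed
    above. *)
Let cfo := op_factorization cf.
Let cfr := mirror_factorization cf.
Let cfro := mirror_factorization cfo.

Let hmA : hom (A ⊗ A) A (mul A).
Proof. by case: (cf_bialgebra cf) => [[[]]]. Qed.
Let hDeltaA : hom A (A ⊗ A) (Delta A).
Proof. by case: (cf_bialgebra cf) => _ [[]]. Qed.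
Let hm1 : hom (B1 ⊗ B1) B1 (mul B1). Proof. by case: (cf_algebra1 cf) => [[]]. Qed.
Let heta1 : hom unit_ob B1 (eta B1). Proof. by case: (cf_algebra1 cf) => [[]]. Qed.
Let hDelta1 : hom B1 (B1 ⊗ B1) (Delta B1).
Proof. by case: (cf_coalgebra1 cf) => [[]]. Qed.
Let heps1 : hom B1 unit_ob (eps B1).
Proof. by case: (cf_coalgebra1 cf) => [[]]. Qed.
Let hm2 : hom (B2 ⊗ B2) B2 (mul B2). Proof. by case: (cf_algebra2 cf) => [[]]. Qed.
Let heta2 : hom unit_ob B2 (eta B2). Proof. by case: (cf_algebra2 cf) => [[]]. Qed.
Let hDelta2 : hom B2 (B2 ⊗ B2) (Delta B2).
Proof. by case: (cf_coalgebra2 cf) => [[]]. Qed.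
Let heps2 : hom B2 unit_ob (eps B2).
Proof. by case: (cf_coalgebra2 cf) => [[]]. Qed.
Let hi1 : hom B1 A i1. Proof. by case: (cf_i1 cf). Qed.
Let hi2 : hom B2 A i2. Proof. by case: (cf_i2 cf). Qed.
Let hp1 : hom A B1 p1. Proof. by case: (cf_p1 cf). Qed.
Let hp2 : hom A B2 p2. Proof. by case: (cf_p2 cf). Qed.

Local Tactic Notation "diagram" constr(rules) uconstr(s1) uconstr(s2) :=
  diagram_in C [:: carrier A; carrier B1; carrier B2]
    (tt, hmA, hDeltaA, hm1, heta1, hDelta1, heps1,
     hm2, heta2, hDelta2, heps2, hi1, hi2, hp1, hp2) rules s1 s2.
Local Ltac typing :=
  typing_in C [:: carrier A; carrier B1; carrier B2]
    (tt, hmA, hDeltaA, hm1, heta1, hDelta1, heps1,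
     hm2, heta2, hDelta2, heps2, hi1, hi2, hp1, hp2).

Local Ltac reassociate H :=
  have := H; rewrite /hd_phi12 /hd_phi21 /=;
  let e := fresh in intro e;
  first [refine (etrans _ (etrans e _)); diagram tt [::] [::]
        |refine (etrans _ (etrans (esym e) _)); diagram tt [::] [::]].

Let phi12E : (p2 ⊗ p1) ∘ Delta A ∘ mul A ∘ (i1 ⊗ i2) = hd_phi12 B1 B2 nu_l nu_r.
Proof. reassociate (factorization_phi21 cfo). Qed.

Lemma factorization_hopf_datum : is_hopf_datum B1 B2 mu_l nu_l mu_r nu_r.
Proof.
split.
- exact: cf_algebra1 cf.
- exact: cf_coalgebra1 cf.
- exact: factorization_eps1 cf.
- by case: (factorization_eps1 cfo) => -[].
- exact: cf_algebra2 cf.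
- exact: cf_coalgebra2 cf.
- exact: factorization_eps1 cfr.
- by case: (factorization_eps1 cfro) => -[].
- exact: factorization_left_module cf.
- case: (factorization_left_module cfo) => _ e1 e2; split; first by typing.
  + reassociate e1.
  + reassociate e2.
- exact: factorization_left_module cfr.
- case: (factorization_left_module cfro) => _ e1 e2; split; first by typing.
  + reassociate e1.
  + reassociate e2.
- exact: factorization_mu_r_eta cf.
- reassociate (factorization_mu_r_eta cfro).
- exact: factorization_eps_mu_r cf.
- by rewrite (factorization_eps_mu_r cfr).
- exact: factorization_mu_r_eta cfr.
- reassociate (factorization_mu_r_eta cfo).
- reassociate (factorization_eps_mu_r cfo).
- reassociate (factorization_eps_mu_r cfro).
- exact: factorization_algebra_coalgebra1 cf.
- reassociate (factorization_algebra_coalgebra1 cfr).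
- rewrite -phi12E -(factorization_phi21 cf) -(factorization_module_comodule cf).
  diagram (tt, cf_inverse_l cf) [:: Rw 0 [:: 3; 4; 5; 6; 7; 8]] [::].
- reassociate (factorization_module_algebra_l cfr).
- exact: factorization_module_algebra_l cf.
- reassociate (factorization_module_algebra_l cfro).
- reassociate (factorization_module_algebra_l cfo).
- reassociate (factorization_module_coalgebra_l cfr).
- exact: factorization_module_coalgebra_l cf.
- reassociate (factorization_module_coalgebra_l cfro).
- reassociate (factorization_module_coalgebra_l cfo).
Qed.

Lemma factorization_comul_morphism phi :
  coalgebra_morphism A (cross_product B1 B2 (hd_phi12 B1 B2 nu_l nu_r) phi)
    ((p1 ⊗ p2) ∘ Delta A).
Proof.
apply: op_algebra_morphismK; rewrite op_cross_product.
(* The brackets are those to which mu_l and mu_r of the opposite factorization reduce. *)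
have -> : hd_phi12 B1 B2 nu_l nu_r = hd_phi21 (op_pre B1) (op_pre B2)
    ((p2 ⊗ p1) ∘ (Delta A ∘ i1)) ((p2 ⊗ p1) ∘ (Delta A ∘ i2)).
  reassociate (erefl (hd_phi12 B1 B2 nu_l nu_r)).
exact: factorization_mul_morphism cfo phi.
Qed.

Lemma factorization_trivial_nu_l :
  Delta A ∘ (i1 ∘ p1) = ((i1 ∘ p1) ⊗ (i1 ∘ p1)) ∘ Delta A ->
  nu_l = eta B2 ⊗ idm B1.
Proof. by move=> h; reassociate (factorization_trivial_mu_l cfo h). Qed.

Lemma factorization_trivial_nu_r :
  Delta A ∘ (i2 ∘ p2) = ((i2 ∘ p2) ⊗ (i2 ∘ p2)) ∘ Delta A ->
  nu_r = idm B2 ⊗ eta B1.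
Proof. by move=> h; reassociate (factorization_trivial_mu_l cfro h). Qed.

End FactorizationHopfDatum.

(** * The equivalences *)

Lemma op_bialgebra_morphism (C : braided_category) (A B : prebialgebra C) f :
  bialgebra_morphism (op_pre B) (op_pre A) f <-> bialgebra_morphism A B f.
Proof.
by split=> -[[[? ?] ? ?] [[? ?] ? ?]]; split; split.
Qed.

Lemma mirror_bialgebra_morphism (C : braided_category) (A B : prebialgebra C) f :
  bialgebra_morphism (mirror_pre A) (mirror_pre B) f <-> bialgebra_morphism A B f.
Proof.
by split=> -[[[? ?] ? ?] [[? ?] ? ?]]; split; split.
Qed.

(** * Bialgebras of trivalent Hopf data *)

Lemma trivial_mu_l_bialgebra (C : braided_category) (B1 B2 : prebialgebra C)
    (nu_l mu_r nu_r : Mor C) :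
  is_hopf_datum B1 B2 (eps B2 ⊗ idm B1) nu_l mu_r nu_r ->
  let B := hopf_datum_bialgebra B1 B2 (eps B2 ⊗ idm B1) nu_l mu_r nu_r in
  is_bialgebra B /\ bialgebra_morphism B B1 (idm B1 ⊗ eps B2).
Proof.
move=> hd B; have hr := mirror_hopf_datum hd.
have e : mirror_pre B =
    hopf_datum_bialgebra (mirror_pre B2) (mirror_pre B1) mu_r nu_r (eps B2 ⊗ idm B1) nu_l.
  rewrite /B /hopf_datum_bialgebra mirror_cross_product; congr cross_product.
  - exact (mirror_hd_phi12 B1 B2 nu_l nu_r).
  - exact (mirror_hd_phi21 B1 B2 _ mu_r).
split; first by apply/mirror_bialgebra; rewrite e; exact: trivial_mu_r_bialgebra hr.
apply/mirror_bialgebra_morphism; rewrite e; exact: trivial_mu_r_projection hr.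
Qed.

Lemma trivial_nu_bialgebra (C : braided_category) (B1 B2 : prebialgebra C)
    (mu_l nu_l mu_r nu_r : Mor C) :
  is_hopf_datum B1 B2 mu_l nu_l mu_r nu_r ->
  let B := hopf_datum_bialgebra B1 B2 mu_l nu_l mu_r nu_r in
  [/\ nu_l = eta B2 ⊗ idm B1 ->
        is_bialgebra B /\ bialgebra_morphism B1 B (idm B1 ⊗ eta B2)
    & nu_r = idm B2 ⊗ eta B1 ->
        is_bialgebra B /\ bialgebra_morphism B2 B (eta B1 ⊗ idm B2)].
Proof.
move=> hd B; have ho := op_hopf_datum hd.
have e : op_pre B =
    hopf_datum_bialgebra (op_pre B1) (op_pre B2) nu_l mu_l nu_r mu_r.
  rewrite /B /hopf_datum_bialgebra op_cross_product; congr cross_product.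
  - exact (op_hd_phi12 hd).
  - exact (op_hd_phi21 hd).
(* The unit of a factor is the counit of its opposite, so a trivial coaction is by conversion a
   trivial action of the opposite datum. *)
split=> triv; rewrite triv in ho e.
- have [h1 h2] := trivial_mu_l_bialgebra ho.
  split; first by apply/op_bialgebra; rewrite e.
  by apply/op_bialgebra_morphism; rewrite e.
- split; first by apply/op_bialgebra; rewrite e; exact: trivial_mu_r_bialgebra ho.
  apply/op_bialgebra_morphism; rewrite e; exact: trivial_mu_r_projection ho.
Qed.

Lemma trivalent_hopf_datum_bialgebra (C : braided_category)
    (B1 B2 : prebialgebra C) (mu_l nu_l mu_r nu_r : Mor C) :
  trivalent_hopf_datum B1 B2 mu_l nu_l mu_r nu_r ->
  is_bialgebra (hopf_datum_bialgebra B1 B2 mu_l nu_l mu_r nu_r) /\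
  trivalent_cross_product B1 B2 (hd_phi12 B1 B2 nu_l nu_r)
    (hd_phi21 B1 B2 mu_l mu_r).
Proof.
move=> [hd]; have [tl tr] := trivial_nu_bialgebra hd.
case=> [e|e|/tl[? ?]|/tr[? ?]].
- by rewrite e in hd *; have [? ?] := trivial_mu_l_bialgebra hd; split=> //; apply: Or44.
- rewrite e in hd *; split; first exact: trivial_mu_r_bialgebra hd.
  by apply: Or43; exact: trivial_mu_r_projection hd.
- by split=> //; apply: Or42.
- by split=> //; apply: Or41.
Qed.

Lemma inverse_sym (C : category) (f g : Mor C) : inverse f g -> inverse g f.
Proof. by case=> e1 e2 e3 e4; split; rewrite ?e3 ?e4 ?e1 ?e2. Qed.

Lemma coalgebra_morphism_inverse (C : braided_category) (A B : prebialgebra C) f g :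
  is_bialgebra A -> is_bialgebra B ->
  coalgebra_morphism A B f -> inverse f g -> coalgebra_morphism B A g.
Proof.
move=> [_ cA _ _ _] [_ cB _ _ _] cf fg; apply: op_algebra_morphismK.
apply: (@algebra_morphism_inverse (op C) (op_pre B) (op_pre A) f g).
- exact: op_algebra.
- exact: op_algebra.
- exact: op_algebra_morphism.
- exact/op_inverse/inverse_sym.
Qed.

Lemma bialgebra_morphism_inverse (C : braided_category) (A B : prebialgebra C) f g :
  is_bialgebra A -> is_bialgebra B ->
  bialgebra_morphism A B f -> inverse f g -> bialgebra_morphism B A g.
Proof.
move=> hA hB [af cf] fg; split; last exact: coalgebra_morphism_inverse cf fg.
by case: hA hB => [aA _ _ _ _] [aB _ _ _ _]; apply: algebra_morphism_inverse af fg.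
Qed.

Lemma coalgebra_morphism_comp (C : braided_category) (A B D : prebialgebra C) f g :
  is_coalgebra A -> is_coalgebra B -> is_coalgebra D ->
  coalgebra_morphism B D f -> coalgebra_morphism A B g ->
  coalgebra_morphism A D (f ∘ g).
Proof.
move=> cA cB cD cf cg; apply: op_algebra_morphismK.
apply: (@algebra_morphism_comp (op C) (op_pre D) (op_pre B) (op_pre A) g f).
- exact: op_algebra.
- exact: op_algebra.
- exact: op_algebra.
- exact: op_algebra_morphism.
- exact: op_algebra_morphism.
Qed.

Lemma bialgebra_morphism_comp (C : braided_category) (A B D : prebialgebra C) f g :
  is_algebra A -> is_algebra B -> is_algebra D ->
  is_coalgebra A -> is_coalgebra B -> is_coalgebra D ->
  bialgebra_morphism B D f -> bialgebra_morphism A B g -> bialgebra_morphism A D (f ∘ g).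
Proof.
move=> aA aB aD cA cB cD [af cf] [ag cg].
by split; [exact: algebra_morphism_comp af ag|exact: coalgebra_morphism_comp cf cg].
Qed.

Lemma op_BAT (C : braided_category) (B1 B2 : prebialgebra C) phi12 phi21 :
  is_BAT B1 B2 phi12 phi21 -> is_BAT (op_pre B1) (op_pre B2) phi21 phi12.
Proof.
case=> a1 c1 e1 a2 c2 e2 h12 h21 hB; split=> //.
- exact: op_algebra.
- exact: op_coalgebra.
- exact: op_algebra.
- exact: op_coalgebra.
- exact: op_hom.
- exact: op_hom.
- exact/op_bialgebra.
Qed.

(** * Factorizations of cross products, their transport, and splittings *)

Section CrossProductFactorization.
Variable C : braided_category.
Variables (B1 B2 : prebialgebra C) (phi12 phi21 : Mor C).
Hypothesis bat : is_BAT B1 B2 phi12 phi21.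

Local Notation B := (cross_product B1 B2 phi12 phi21).
Local Notation j1 := (idm B1 ⊗ eta B2).
Local Notation j2 := (eta B1 ⊗ idm B2).
Local Notation q1 := (idm B1 ⊗ eps B2).
Local Notation q2 := (eps B1 ⊗ idm B2).

(** Here both arrows that have to be mutually inverse are identities: [mul B ∘ (j1 ⊗ j2)] by
    [cross_product_mul_inclusions], and [(q1 ⊗ q2) ∘ Delta B] by the same lemma in the opposite
    category. *)
Lemma cross_product_factorization : cross_factorization B B1 B2 j1 j2 q1 q2.
Proof.
have bo := op_BAT bat; case: (bat) => a1 c1 e1 a2 c2 e2 h12 h21 hB.
have [aB cB _ _ _] := hB; have hid := hom_idm B.
have dB : hom B (B ⊗ B) (Delta B) by case: cB => -[].
split=> //.
- exact: cross_product_inclusion1.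
- exact: cross_product_inclusion2 bat.
- exact/op_algebra_morphismK/(cross_product_inclusion1 bo).
- exact/op_algebra_morphismK/(cross_product_inclusion2 bo).
- exact: cross_product_retract1 bat.
- exact: cross_product_retract2 bat.
- rewrite (cross_product_mul_inclusions bat).
  by rewrite [X in _ ∘ X](cross_product_mul_inclusions bo) (comp_idL hid).
- rewrite (cross_product_mul_inclusions bat).
  by rewrite [X in X ∘ _](cross_product_mul_inclusions bo) (comp_idL hid).
Qed.
End CrossProductFactorization.

Section TransportFactorization.
Variable C : braided_category.
Variables (A B B1 B2 : prebialgebra C) (f g i1 i2 p1 p2 : Mor C).
Hypothesis bialgA : is_bialgebra A.
Hypothesis cf : cross_factorization B B1 B2 i1 i2 p1 p2.
Hypothesis bf : bialgebra_morphism A B f.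
Hypothesis fg_inv : inverse f g.

Lemma transport_factorization :
  cross_factorization A B1 B2 (g ∘ i1) (g ∘ i2) (p1 ∘ f) (p2 ∘ f).
Proof.
have [aA cA _ _ _] := bialgA; have bialgB := cf_bialgebra cf.
have [aB cB _ _ _] := bialgB.
have [ag cg] := bialgebra_morphism_inverse bialgA bialgB bf fg_inv.
have [af ccf] := bf; case: (cf) => _ a1 c1 a2 c2 ai1 ai2 cp1 cp2 pi1 pi2 inv1 inv2.
have [[hmA _] _ _ _] := aA; have [[hdA _] _ _ _] := cA.
have [[hmB _] _ _ _] := aB; have [[hdB _] _ _ _] := cB.
have [[hi1 _ _] [hi2 _ _]] := (ai1, ai2); have [[hp1 _ _] [hp2 _ _]] := (cp1, cp2).
have [hf _ _] := af; have [hg gm _] := ag; have [_ fd _] := ccf.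
have [_ _ fg gf] := fg_inv; rewrite (proj2 hf) in fg; rewrite (proj1 hf) in gf.
split=> //.
- exact: algebra_morphism_comp ag ai1.
- exact: algebra_morphism_comp ag ai2.
- exact: coalgebra_morphism_comp cp1 ccf.
- exact: coalgebra_morphism_comp cp2 ccf.
- diagram_in C [:: carrier A; carrier B; carrier B1; carrier B2] (tt, hmA,
      hdA, hmB, hdB, hf, hg, hi1, hi2, hp1, hp2) (tt, fg, pi1)
    [:: Rw 0 [:: 1; 2]; Rw 1 [:: 0; 1]]
    [::].
- diagram_in C [:: carrier A; carrier B; carrier B1; carrier B2] (tt, hmA,
      hdA, hmB, hdB, hf, hg, hi1, hi2, hp1, hp2) (tt, fg, pi2)
    [:: Rw 0 [:: 1; 2]; Rw 1 [:: 0; 1]]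
    [::].
- diagram_in C [:: carrier A; carrier B; carrier B1; carrier B2] (tt, hmA,
      hdA, hmB, hdB, hf, hg, hi1, hi2, hp1, hp2) (tt, gm, fd, inv1, gf)
    [:: RwR 0 [:: 0; 1; 5]; RwR 1 [:: 4; 7; 8]; Rw 2 [:: 1; 2; 3; 4; 5; 6];
      Rw 3 [:: 0; 1]]
    [::].
- diagram_in C [:: carrier A; carrier B; carrier B1; carrier B2] (tt, hmA,
      hdA, hmB, hdB, hf, hg, hi1, hi2, hp1, hp2) (tt, gm, fd, inv2, fg)
    [:: RwR 0 [:: 5; 6; 8]; RwR 1 [:: 1; 3; 4]; Rw 3 [:: 3; 4];
      Rw 2 [:: 0; 1; 2; 3; 4; 5]]
    [::].
Qed.

End TransportFactorization.

(** The two equations of the splitting, with idempotents i_j p_j, become those of the inverse pair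
    by inserting or cancelling p_j ∘ i_j = id at the ends. *)
Lemma split_factorization (C : braided_category) (A : prebialgebra C) (N1 N2 : Ob C)
    (i1 i2 p1 p2 : Mor C) :
  is_bialgebra A ->
  hom A N1 p1 -> hom N1 A i1 -> p1 ∘ i1 = idm N1 ->
  hom A N2 p2 -> hom N2 A i2 -> p2 ∘ i2 = idm N2 ->
  compatible_idempotent A (i1 ∘ p1) -> compatible_idempotent A (i2 ∘ p2) ->
  splitting (A ⊗ A) A ((i1 ∘ p1) ⊗ (i2 ∘ p2))
    (mul A ∘ ((i1 ∘ p1) ⊗ (i2 ∘ p2))) (((i1 ∘ p1) ⊗ (i2 ∘ p2)) ∘ Delta A) ->
  cross_factorization A (split_prebialgebra A N1 p1 i1)
    (split_prebialgebra A N2 p2 i2) i1 i2 p1 p2.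
Proof.
move=> hA hp1 hi1 pi1 hp2 hi2 pi2 comp1 comp2 [_ _ sp1 sp2].
have [aA cA _ _ _] := hA.
have [[hmA _] _ _ _] := aA; have [[hdA _] _ _ _] := cA.
split=> //.
- exact: split_algebra.
- exact: split_coalgebra.
- exact: split_algebra.
- exact: split_coalgebra.
- exact: split_inclusion.
- exact: split_inclusion.
- exact: split_projection.
- exact: split_projection.
- diagram_in C [:: carrier A; N1; N2] (tt, hmA, hdA, hi1, hi2, hp1, hp2)
      (tt, sp1, pi1, pi2)
    [::]
    [:: InsR 0 0 0; Rw 1 [:: 6; 7]; Rw 2 [:: 2; 3]].
- rewrite /=.
  diagram_in C [:: carrier A; N1; N2] (tt, hmA, hdA, hi1, hi2, hp1, hp2)
      (tt, sp2, pi1, pi2)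
    [:: InsR 1 0 0; InsR 1 8 0; InsR 2 0 1; InsR 2 9 1]
    [:: InsR 1 0 0; InsR 1 0 0; InsR 2 0 1; InsR 2 0 1;
      RwR 0 [:: 1; 2; 5; 6]].
Qed.

(** One arrow is known to preserve products and its inverse to preserve coproducts; together they
    make the isomorphism one of bialgebras. *)
Lemma factorization_isomorphic (C : braided_category) (A B1 B2 : prebialgebra C)
    (i1 i2 p1 p2 : Mor C) :
  cross_factorization A B1 B2 i1 i2 p1 p2 ->
  let B := hopf_datum_bialgebra B1 B2 (p1 ∘ mul A ∘ (i2 ⊗ i1))
    ((p2 ⊗ p1) ∘ Delta A ∘ i1) (p2 ∘ mul A ∘ (i2 ⊗ i1))
    ((p2 ⊗ p1) ∘ Delta A ∘ i2) in
  is_bialgebra B -> bialgebra_isomorphic B A.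
Proof.
move=> cf B bialgB; have fg := factorization_inverse cf.
have af : algebra_morphism B A (mul A ∘ (i1 ⊗ i2)).
  exact: factorization_mul_morphism cf _.
have cg : coalgebra_morphism A B ((p1 ⊗ p2) ∘ Delta A).
  exact: factorization_comul_morphism cf _.
exists (mul A ∘ (i1 ⊗ i2)), ((p1 ⊗ p2) ∘ Delta A); split=> //; split=> //.
exact: coalgebra_morphism_inverse (cf_bialgebra cf) bialgB cg (inverse_sym fg).
Qed.

Unset Implicit Arguments.

Theorem theorem2p16 (C : braided_category) (hC : idempotents_split C)
    (A : prebialgebra C) (hA : is_bialgebra A) :
  [<-> exists (B1 B2 : prebialgebra C) (mu_l nu_l mu_r nu_r : Mor C),
         trivalent_hopf_datum B1 B2 mu_l nu_l mu_r nu_r /\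
         bialgebra_isomorphic (hopf_datum_bialgebra B1 B2 mu_l nu_l mu_r nu_r) A;

       exists (B1 B2 : prebialgebra C) (phi12 phi21 : Mor C),
         [/\ is_BAT B1 B2 phi12 phi21,
             trivalent_cross_product B1 B2 phi12 phi21
           & bialgebra_isomorphic A (cross_product B1 B2 phi12 phi21)];

       exists (B1 B2 : prebialgebra C) (i1 i2 p1 p2 : Mor C),
         [/\ [/\ is_algebra B1, is_coalgebra B1, is_algebra B2
               & is_coalgebra B2],
             [/\ algebra_morphism B1 A i1, coalgebra_morphism A B1 p1,
                 algebra_morphism B2 A i2 & coalgebra_morphism A B2 p2],
             p1 ∘ i1 = idm B1 /\ p2 ∘ i2 = idm B2,
             inverse (mul A ∘ (i1 ⊗ i2)) ((p1 ⊗ p2) ∘ Delta A)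
           & [\/ bialgebra_morphism B1 A i1, bialgebra_morphism B2 A i2,
                 bialgebra_morphism A B1 p1 | bialgebra_morphism A B2 p2]];

       exists Pi1 Pi2 : Mor C,
         let compatible (Pi : Mor C) : Prop :=
           [/\ mul A ∘ (Pi ⊗ Pi) = Pi ∘ mul A ∘ (Pi ⊗ Pi),
               Pi ∘ eta A = eta A,
               (Pi ⊗ Pi) ∘ Delta A = (Pi ⊗ Pi) ∘ Delta A ∘ Pi
             & eps A ∘ Pi = eps A] in
         [/\ is_idempotent A Pi1 /\ is_idempotent A Pi2,
             compatible Pi1 /\ compatible Pi2,
             splitting (A ⊗ A) A (Pi1 ⊗ Pi2)
               (mul A ∘ (Pi1 ⊗ Pi2)) ((Pi1 ⊗ Pi2) ∘ Delta A)
           & [\/ algebra_morphism A A Pi1, coalgebra_morphism A A Pi1,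
                 algebra_morphism A A Pi2 | coalgebra_morphism A A Pi2]]].
Proof.
tfae.
- move=> [B1 [B2 [mu_l [nu_l [mu_r [nu_r [tri iso]]]]]]].
  have [bialgB triB] := trivalent_hopf_datum_bialgebra tri; have [hd _] := tri.
  exists B1, B2, (hd_phi12 B1 B2 nu_l nu_r), (hd_phi21 B1 B2 mu_l mu_r); split=> //.
  + case: (hd) => a1 c1 [_ _ e1] u1 a2 c2 [_ _ e2] u2 *; split=> //.
      exact: hom_hd_phi12 hd.
    exact: hom_hd_phi21 hd.
  + case: iso => f [g [bf fg]]; exists g, f; split; last exact: inverse_sym.
    exact: bialgebra_morphism_inverse bf fg.
- move=> [B1 [B2 [phi12 [phi21 [bat tri [f [g [bf fg]]]]]]]].
  have cfB := cross_product_factorization bat.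
  have cf := transport_factorization hA cfB bf fg.
  have bialgB := BAT_bialgebra bat.
  have bg := bialgebra_morphism_inverse hA bialgB bf fg.
  (* The four arrows are determined by unification with the morphisms recorded in [cf]. *)
  exists B1, B2; do 4!eexists; split.
  + by case: (cf).
  + by case: (cf); split; eassumption.
  + by case: (cf).
  + exact: factorization_inverse cf.
  + have [aA cA _ _ _] := hA; have [aB cB _ _ _] := bialgB.
    have [_ a1 c1 a2 c2 _ _ _ _ _ _ _ _] := cf.
    (* The indices cross over because [trivalent_cross_product] lists the maps of B2 before those of
       B1. *)
    case: tri => h.
    * by apply: Or42; apply: bialgebra_morphism_comp bg h.
    * by apply: Or41; apply: bialgebra_morphism_comp bg h.
    * by apply: Or44; apply: bialgebra_morphism_comp h bf.
    * by apply: Or43; apply: bialgebra_morphism_comp h bf.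
- move=> [B1 [B2 [i1 [i2 [p1 [p2 [[a1 c1 a2 c2] [ai1 cp1 ai2 cp2] [e1 e2] inv tri]]]]]]].
  have hf : hom (B1 ⊗ B2) A (mul A ∘ (i1 ⊗ i2)).
    have [[[hmA _] _ _ _] _ _ _ _] := hA; apply: hom_comp hmA _.
    by case: ai1 ai2 => [hi1 _ _] [hi2 _ _]; apply: hom_tensor.
  have cf : cross_factorization A B1 B2 i1 i2 p1 p2.
    case: inv => _ _ inv_l inv_r; split=> //.
      by rewrite inv_l; case: hf => _ ->.
    by rewrite inv_r; case: hf => ->.
  have [_ cA _ _ _] := hA; have [aA _ _ _ _] := hA.
  exists (i1 ∘ p1), (i2 ∘ p2); split.
  + split; first exact: factorization_idempotent1 cf.
    exact: (factorization_idempotent1 (mirror_factorization cf)).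
  + split; first exact: factorization_compatible1 cf.
    exact: (factorization_compatible1 (mirror_factorization cf)).
  + exact: factorization_splitting cf.
  (* p_j is already a coalgebra morphism and i_j an algebra morphism; the extra condition on one of
     them makes i_j ∘ p_j a morphism of the corresponding kind. *)
  + case: tri => -[ha hc].
    * by apply: Or42; apply: coalgebra_morphism_comp hc cp1.
    * by apply: Or44; apply: coalgebra_morphism_comp hc cp2.
    * by apply: Or41; apply: algebra_morphism_comp ai1 ha.
    * by apply: Or43; apply: algebra_morphism_comp ai2 ha.
- move=> [Pi1 [Pi2 [[id1 id2] [comp1 comp2] sp tri]]].
  (* The splitting of idempotents in the category is used here: the images of Π_1 and Π_2 are to
     become the factors. *)
  have [N1 [p1 [i1 [hp1 hi1 pi1 e1]]]] := hC _ _ id1.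
  have [N2 [p2 [i2 [hp2 hi2 pi2 e2]]]] := hC _ _ id2.
  subst Pi1 Pi2.
  have cf := split_factorization hA hp1 hi1 pi1 hp2 hi2 pi2 comp1 comp2 sp.
  have cr := mirror_factorization cf.
  pose mu_l := p1 ∘ mul A ∘ (i2 ⊗ i1); pose mu_r := p2 ∘ mul A ∘ (i2 ⊗ i1).
  pose nu_l := (p2 ⊗ p1) ∘ Delta A ∘ i1; pose nu_r := (p2 ⊗ p1) ∘ Delta A ∘ i2.
  exists (split_prebialgebra A N1 p1 i1), (split_prebialgebra A N2 p2 i2).
  exists mu_l, nu_l, mu_r, nu_r.
  suff t : trivalent_hopf_datum (split_prebialgebra A N1 p1 i1)
      (split_prebialgebra A N2 p2 i2) mu_l nu_l mu_r nu_r.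
    split=> //; have [bialgB _] := trivalent_hopf_datum_bialgebra t.
    exact: factorization_isomorphic cf bialgB.
  split; first exact: factorization_hopf_datum cf.
  case: tri => -[_ h _].
  + by apply: Or41; exact: (factorization_trivial_mu_l cf).
  + by apply: Or43; exact: (factorization_trivial_nu_l cf).
  + by apply: Or42; exact: (factorization_trivial_mu_l cr).
  + by apply: Or44; exact: (factorization_trivial_nu_r cf).
Qed.
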